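(* Let $(A,\mathfrak{m})$ be a commutative Noetherian local ring, let $M$ be a finitely generated $A$-module with $\dim M>0$ and let $I$ be an $\mathfrak{m}$-primary ideal of $A$. Then $r_I^M=\dim M-1$; that is, for every non-zero object $X_\bullet$ of $K^b_f(\operatorname{proj} A)$ the function of polynomial type $$\psi_{X_\bullet}^{M,I}(n) = \sum_{i\in\mathbb{Z}} \ell\big(H^i(X_\bullet\otimes_A M/I^nM)\big), \qquad n\geq 1,$$ has degree $\dim M-1$.
   Context: $\ell(T)$ denotes the length of an $A$-module $T$ of finite length. $K^b(\operatorname{proj} A)$ is the homotopy category of bounded complexes of finitely generated projective $A$-modules (complexes indexed cohomologically), and $K^b_f(\operatorname{proj} A)$ is its full subcategory of complexes all of whose cohomology modules have finite length. An object is non-zero if it is not isomorphic to $0$ in the homotopy category, equivalently its cohomology is not identically zero. A function $f:\mathbb{Z}_{\ge 1}\to\mathbb{Z}$ is of polynomial type if there is a polynomial $p\in\mathbb{Q}[t]$ with $f(n)=p(n)$ for all $n\gg 0$; its degree is the degree of $p$. It is known that $\psi_{X_\bullet}^{M,I}$ is of polynomial type. The integer $r_I^M$ is the common value of the degree of $\psi_{X_\bullet}^{M,I}$ over all non-zero $X_\bullet\in K^b_f(\operatorname{proj} A)$ (this degree is independent of the choice of non-zero $X_\bullet$). *)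

(* Defs.v *)
From HB Require Import structures.
From mathcomp Require Import all_boot all_order all_algebra.
From mathcomp Require Import boolp classical_sets fsbigop.
From mathcomp Require Import freeg.

Set Implicit Arguments.
Unset Strict Implicit.
Unset Printing Implicit Defensive.

Import Order.TTheory GRing.Theory.

Local Open Scope classical_set_scope.
Local Open Scope ring_scope.
Local Open Scope quotient_scope.

(* Over a ring, scaling by -1 makes a [submodClosed] a [zmodClosed], which is
   what the library's quotients need. *)
Section SubmodOpp.
Variables (R : nzRingType) (V : lmodType R) (W : submodClosed V).

Lemma submod_oppr_closed : oppr_closed W.
Proof. by move=> x xW; rewrite -scaleN1r; exact: rpredZ. Qed.

Let submod_oppr := GRing.isOppClosed.Build V (GRing.SubmodClosed.sort W)
  submod_oppr_closed.

Definition submod_zmod : zmodClosed V :=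
  HB.pack_for (zmodClosed V) (GRing.SubmodClosed.sort W) submod_oppr.

End SubmodOpp.

Section SubmodType.
Variables (R : nzRingType) (V : lmodType R) (W : submodClosed V).

Record submod_type := SubmodType { submod_val :> V; _ : submod_val \in W }.

HB.instance Definition _ := [isSub for submod_val].
HB.instance Definition _ := [Choice of submod_type by <:].
HB.instance Definition _ := [SubChoice_isSubLmodule of submod_type by <:].

End SubmodType.

(* MathComp equips [{ideal_quot (GRing.SubmodClosed.sort W)}] with a group structure only. *)
Section QuotientModule.
Variables (R : nzRingType) (V : lmodType R) (W : submodClosed V).

Definition quotmod := {ideal_quot submod_zmod W}.

HB.instance Definition _ := GRing.Zmodule.on quotmod.
HB.instance Definition _ : EqQuotient V (Quotient.equiv (submod_zmod W)) quotmod :=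
  EqQuotient.on quotmod.
HB.instance Definition _ := ZmodQuotient.on quotmod.

Definition quot_scale (a : R) := lift_op1 quotmod ( *:%R a).

Lemma pi_quot_scale a : {morph \pi_quotmod : x / a *: x >-> quot_scale a x}.
Proof.
move=> x; unlock quot_scale; apply/eqP; rewrite piE Quotient.equivE -scalerBr.
apply: (@rpredZ R V W).
by rewrite -[_ \in _]/(_ \in submod_zmod W) Quotient.idealrBE reprK.
Qed.

Let scaleA a b x : quot_scale a (quot_scale b x) = quot_scale (a * b) x.
Proof. by rewrite -[x]reprK -!pi_quot_scale scalerA. Qed.

Let scale1 : left_id 1 quot_scale.
Proof. by move=> x; rewrite -[x]reprK -pi_quot_scale scale1r. Qed.

Let scaleDr : right_distributive quot_scale +%R.
Proof.
move=> a x y; rewrite -[x]reprK -[y]reprK -!raddfD -!pi_quot_scale.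
by rewrite -raddfD scalerDr.
Qed.

Let scaleDl x : {morph quot_scale^~ x : a b / a + b}.
Proof. by move=> a b; rewrite -[x]reprK -!pi_quot_scale -raddfD scalerDl. Qed.

HB.instance Definition _ :=
  GRing.Zmodule_isLmodule.Build R quotmod scaleA scale1 scaleDr scaleDl.

Definition quot_pi : V -> quotmod := \pi_quotmod.

Lemma quot_pi_linear : linear quot_pi.
Proof. by move=> a x y; rewrite /quot_pi raddfD; congr (_ + _); exact: pi_quot_scale. Qed.

HB.instance Definition _ := GRing.isLinear.Build R V quotmod *:%R quot_pi
  quot_pi_linear.

Lemma quot_pi_eq0 x : (quot_pi x == 0) = (x \in W).
Proof.
rewrite -(raddf0 quot_pi) -[X in _ = (X \in _)]subr0.
by rewrite -[RHS]/(_ \in submod_zmod W) Quotient.idealrBE.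
Qed.

Lemma quot_pi_reprK (u : quotmod) : quot_pi (repr u) = u.
Proof. exact: reprK. Qed.

(* A linear map that kills W factors through the quotient. *)
Section Lift.
Variables (U : lmodType R) (f : {linear V -> U}).

Definition quot_lift (u : quotmod) : U := f (repr u).

Hypothesis f0 : {in W, forall x, f x = 0}.

Lemma quot_lift_pi x : quot_lift (quot_pi x) = f x.
Proof.
apply/eqP; rewrite -subr_eq0 /quot_lift -raddfB; apply/eqP/f0.
by rewrite -quot_pi_eq0 raddfB /= quot_pi_reprK subrr.
Qed.

Lemma quot_lift_linear : linear quot_lift.
Proof.
move=> a u v; rewrite -[u]quot_pi_reprK -[v]quot_pi_reprK -linearP.
by rewrite !quot_lift_pi linearP.
Qed.

End Lift.

End QuotientModule.

Section KernelImage.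
Variables (R : nzRingType) (V U : lmodType R) (f : {linear V -> U}).

Definition lin_ker : {pred V} := fun x => f x == 0.
Definition lin_im : {pred U} := fun y => `[< exists x, f x = y >].

Let lin_ker_closed : submod_closed lin_ker.
Proof.
split=> [|a x y]; rewrite -!topredE /= /lin_ker ?raddf0 //.
by move=> /eqP fx /eqP fy; rewrite linearP fx fy scaler0 addr0.
Qed.

HB.instance Definition _ :=
  GRing.isSubmodClosed.Build R V lin_ker lin_ker_closed.

Let lin_im_closed : submod_closed lin_im.
Proof.
split=> [|a _ _ /asboolP[x <-] /asboolP[y <-]]; apply/asboolP.
  by exists 0; rewrite raddf0.
by exists (a *: x + y); rewrite linearP.
Qed.

HB.instance Definition _ := GRing.isSubmodClosed.Build R U lin_im lin_im_closed.

End KernelImage.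

Section Span.
Variables (R : nzRingType) (V : lmodType R) (S : set V).

Definition span : {pred V} := fun x =>
  `[< forall W : submodClosed V, {in S, forall s, s \in W} -> x \in W >].

Lemma spanP x : reflect
  (forall W : submodClosed V, {in S, forall s, s \in W} -> x \in W)
  (x \in span).
Proof. exact: asboolP. Qed.

Lemma mem_span x : S x -> x \in span.
Proof. by move=> Sx; apply/spanP => W; apply; rewrite inE. Qed.

Let span_closed : submod_closed span.
Proof.
split=> [|a x y xS yS]; apply/spanP => W SW; first exact: rpred0.
by apply: rpredD; [apply: rpredZ|]; move: SW; apply/spanP.
Qed.

HB.instance Definition _ :=
  GRing.isSubmodClosed.Build R V span span_closed.

End Span.

Definition fin_gen (R : nzRingType) (V : lmodType R) :=
  exists s : seq V, span [set` s] =i predT.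

(* Every ideal (submodule of the regular module [A^o]) is finitely generated. *)
Definition noetherian (A : comNzRingType) :=
  forall J : submodClosed A^o, exists s : seq A^o, span [set` s] =i J.

(* [idealr A] is the library's type of proper ideals. *)
Definition maximal_ideal (A : comNzRingType) (m : idealr A) :=
  forall J : idealr A, {subset m <= J} -> J =i m.

Definition local_ring (A : comNzRingType) (m : idealr A) :=
  maximal_ideal m /\ forall m' : idealr A, maximal_ideal m' -> m' =i m.

Definition primary_ideal (A : comNzRingType) (I : idealr A) :=
  forall x y, x * y \in I -> x \in I \/ exists n, y ^+ n \in I.

Definition primary_to (A : comNzRingType) (m I : idealr A) :=
  primary_ideal I /\ forall x, x \in m <-> exists n, x ^+ n \in I.

(* The supremum of a set of natural numbers, 0 if empty or unbounded. *)
Definition nat_sup (P : set nat) : nat :=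
  xget 0%N [set n | P n /\ forall k, P k -> (k <= n)%N].

(* Strict chains F 0 < F 1 < ... < F n have length n. *)
Definition chain_lengths (T : Type) (C : set (set T)) : set nat :=
  [set n | exists F : nat -> set T,
     (forall i, (i <= n)%N -> C (F i)) /\
     (forall i, (i < n)%N -> F i `<` F i.+1)].

Section Length.
Variables (R : nzRingType) (V : lmodType R).

Definition submodule_chains :=
  chain_lengths [set W : set V | submod_closed (mem W)].

Definition finite_length := exists n, forall k, submodule_chains k -> (k <= n)%N.

Definition length := nat_sup submodule_chains.

End Length.

(* The Krull dimension of a finitely generated module: the supremum of the
   lengths of chains of primes of its support V(Ann M); by the convention of
   [nat_sup] it is 0, not -oo, for the zero module. *)
Section KrullDim.
Variables (A : comNzRingType) (M : lmodType A).

Definition annihilator : set A := [set a | forall x : M, a *: x = 0].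

Definition support_prime (P : set A) :=
  [/\ idealr_closed (mem P), prime_idealr_closed (mem P) & annihilator `<=` P].

Definition krull_dim := nat_sup (chain_lengths support_prime).

End KrullDim.

Section IdealPower.
Variables (A : comNzRingType) (I : idealr A).

Fixpoint ideal_pow n : set A :=
  if n is k.+1 then
    [set` @span A A^o [set x | exists a b, [/\ a \in I, b \in ideal_pow k & x = a * b]]]
  else setT.

(* the submodule I^n M of M *)
Definition pow_submod (M : lmodType A) n : {pred M} :=
  span [set x | exists a (y : M), a \in ideal_pow n /\ x = a *: y].

HB.instance Definition _ (M : lmodType A) n :=
  GRing.SubmodClosed.on (@pow_submod M n).

End IdealPower.

Arguments pow_submod {A} I M n.

Section FreeModule.
Variables (R : nzRingType) (K : choiceType).

Lemma freegUZ (a k : R) (x : K) :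
  a *: << k *g x >> = << a * k *g x >> :> {freeg K / R}.
Proof. by apply/eqP/freeg_eqP => y; rewrite coeffZ !coeffU mulrA. Qed.

Variable U : lmodType R.

Lemma fglift_linear (f : K -> U) : linear (@fglift R U K f).
Proof.
have fB := lift_is_additive f; have f0 : fglift f 0 = 0.
  by rewrite -(subrr 0) fB subrr.
have fD u v : fglift f (u + v) = fglift f u + fglift f v.
  by rewrite -[v in LHS]opprK fB -[- v]sub0r fB f0 sub0r opprK.
have fsum I (r : seq I) (F : I -> {freeg K / R}) :
    fglift f (\sum_(i <- r) F i) = \sum_(i <- r) fglift f (F i).
  exact: big_morph.
move=> a u v; rewrite fD; congr (_ + _).
rewrite -[u]freeg_sumE scaler_sumr !fsum scaler_sumr.
by apply: eq_bigr => k _; rewrite freegUZ !liftU scalerA.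
Qed.

HB.instance Definition _ (f : K -> U) :=
  GRing.isLinear.Build R {freeg K / R} U *:%R (@fglift R U K f)
    (fglift_linear f).

Lemma freeg_ext (f g : {linear {freeg K / R} -> U}) :
  (forall k, f << k >> = g << k >>) -> f =1 g.
Proof.
rewrite /reverse_coercion in f g *; move=> fg D; rewrite -[D]freeg_sumE !linear_sum; apply: eq_bigr => k _.
by rewrite -[coeff k D]mulr1 -freegUZ !linearZ fg.
Qed.

End FreeModule.

Section Tensor.
Variables (A : comNzRingType) (P N : lmodType A).

Definition tensor_free := {freeg (Choice.clone (P * N)%type _) / A}.

HB.instance Definition _ := GRing.Lmodule.on tensor_free.

Definition gen (x : P) (y : N) : tensor_free := << (x, y) >>.

Definition tensor_rel : set tensor_free :=
  [set r | exists a x x' y, r = gen (a *: x + x') y - a *: gen x y - gen x' y]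
  `|` [set r | exists a x y y', r = gen x (a *: y + y') - a *: gen x y - gen x y'].

Definition tensor := quotmod (span tensor_rel).

HB.instance Definition _ := GRing.Lmodule.on tensor.
HB.instance Definition _ := Quotient.on tensor.


Definition tens (x : P) (y : N) : tensor := quot_pi _ (gen x y).

Lemma tensPl a x x' y : tens (a *: x + x') y = a *: tens x y + tens x' y.
Proof.
apply/eqP; rewrite -subr_eq0 opprD addrA -linearZ -!raddfB quot_pi_eq0.
by apply: mem_span; left; exists a, x, x', y.
Qed.

Lemma tensPr a x y y' : tens x (a *: y + y') = a *: tens x y + tens x y'.
Proof.
apply/eqP; rewrite -subr_eq0 opprD addrA -linearZ -!raddfB quot_pi_eq0.
by apply: mem_span; right; exists a, x, y, y'.
Qed.

(* The universal property: a bilinear map factors through the tensor product. *)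
Section Lift.
Variables (U : lmodType A) (b : P -> N -> U).

Definition free_lift : tensor_free -> U :=
  fglift (fun p : P * N => b p.1 p.2).

HB.instance Definition _ := GRing.isLinear.Build A tensor_free U *:%R free_lift
  (fglift_linear (fun p : P * N => b p.1 p.2)).

Definition tensor_lift : tensor -> U := quot_lift free_lift.

Hypothesis b_linl : forall y, linear (b^~ y).
Hypothesis b_linr : forall x, linear (b x).

Let free_lift_gen x y : free_lift (gen x y) = b x y.
Proof. by rewrite [LHS]liftU scale1r. Qed.

Let free_lift_rel0 : {in span tensor_rel, forall r, free_lift r = 0}.
Proof.
move=> r /spanP/(_ (lin_ker free_lift)) rK; apply/eqP/rK => {r rK} s.
rewrite inE -topredE /= /lin_ker => -[] [a [x [y [z ->]]]];
  rewrite !linearB linearZ /= !free_lift_gen ?b_linl ?b_linr;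
  by rewrite -addrA -opprD subrr.
Qed.

Lemma tensor_lift_linear : linear tensor_lift.
Proof. exact: quot_lift_linear. Qed.

Lemma tensor_lift_tens x y : tensor_lift (tens x y) = b x y.
Proof. by rewrite /tensor_lift quot_lift_pi // free_lift_gen. Qed.

End Lift.

Lemma tensor_ext (U : lmodType A) (f g : {linear tensor -> U}) :
  (forall x y, f (tens x y) = g (tens x y)) -> f =1 g.
Proof.
move=> fg t; rewrite -[t]quot_pi_reprK.
apply: (@freeg_ext _ _ _ (f \o @quot_pi _ _ _) (g \o @quot_pi _ _ _)).
by case=> x y; exact: (fg x y).
Qed.

End Tensor.

Section TensorMap.
Variables (A : comNzRingType) (P Q N : lmodType A) (f : {linear P -> Q}).

(* f (x) id_N *)
Definition tensor_map : tensor P N -> tensor Q N :=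
  tensor_lift (fun x y => tens (f x) y).

Let tens_linl y : linear (fun x => tens (f x) y : tensor Q N).
Proof. by move=> a x x'; rewrite linearP tensPl. Qed.

Let tens_linr x : linear (fun y => tens (f x) y : tensor Q N).
Proof. by move=> a y y'; rewrite tensPr. Qed.

Let tensor_map_linear : linear tensor_map.
Proof. exact: tensor_lift_linear. Qed.

HB.instance Definition _ :=
  GRing.isLinear.Build A (tensor P N) (tensor Q N) *:%R tensor_map
    tensor_map_linear.

Lemma tensor_map_tens x y : tensor_map (tens x y) = tens (f x) y.
Proof. exact: tensor_lift_tens. Qed.

End TensorMap.

(* Cochain complexes.  [diff i j] is the differential when j = i + 1 and is zero
   otherwise, which avoids transporting along equalities of indices. *)
Record complex (A : comNzRingType) := Complex {
  term :> int -> lmodType A;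
  diff : forall i j, {linear term i -> term j};
  diff_shape : forall i j, j != i + 1 -> forall x, diff i j x = 0;
  diff_diff : forall i j k x, diff j k (diff i j x) = 0
}.

Arguments diff {A} c i j.

Section Cohomology.
Variables (A : comNzRingType) (X : complex A) (i : int).

Definition cocycles := submod_type (lin_ker (diff X i (i + 1))).

Definition coboundary : {pred cocycles} :=
  fun z => submod_val z \in lin_im (diff X (i - 1) i).

Let coboundary_closed : submod_closed coboundary.
Proof.
split=> [|a x y]; rewrite -!topredE /= /coboundary; first exact: rpred0.
by move=> xB yB; apply: rpredD => //; apply: rpredZ.
Qed.

HB.instance Definition _ :=
  GRing.isSubmodClosed.Build A cocycles coboundary coboundary_closed.

Definition cohomology := quotmod coboundary.

End Cohomology.

Section TensorComplex.
Variables (A : comNzRingType) (X : complex A) (N : lmodType A).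

Let tdiff i j : {linear tensor (X i) N -> tensor (X j) N} :=
  tensor_map (N := N) (diff X i j).

Let tens0 (P : lmodType A) y : tens 0 y = 0 :> tensor P N.
Proof. by rewrite -(addNr (0 : P)) -scaleN1r tensPl scaleN1r addNr. Qed.

Let tdiff_shape i j : j != i + 1 -> forall t, tdiff i j t = 0.
Proof.
move=> ji; apply: (@tensor_ext _ _ _ _ (tdiff i j) \0) => x y.
by rewrite [LHS]tensor_map_tens diff_shape // tens0.
Qed.

Let tdiff_diff i j k t : tdiff j k (tdiff i j t) = 0.
Proof.
move: t; apply: (@tensor_ext _ _ _ _ (tdiff j k \o tdiff i j) \0) => x y.
rewrite /= [X in tensor_map _ X]tensor_map_tens [LHS]tensor_map_tens.
by rewrite diff_diff tens0.
Qed.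

Definition tensor_complex : complex A := Complex tdiff_shape tdiff_diff.

End TensorComplex.

Section Homotopy.
Variable A : comNzRingType.
Implicit Types X Y : complex A.

Record chain_map X Y := ChainMap {
  chain_fun :> forall i, {linear X i -> Y i};
  chain_comm : forall i j x, chain_fun j (diff X i j x) = diff Y i j (chain_fun i x)
}.

Definition homotopic X Y (f g : forall i, X i -> Y i) :=
  exists h : forall i j, {linear X i -> Y j}, forall i x,
    f i x - g i x = h (i + 1) i (diff X i (i + 1) x)
                    + diff Y (i - 1) i (h i (i - 1) x).

(* isomorphism in the homotopy category *)
Definition homotopy_equivalent X Y :=
  exists (f : chain_map X Y) (g : chain_map Y X),
    homotopic (fun i => g i \o f i) (fun i => @id (X i)) /\
    homotopic (fun i => f i \o g i) (fun i => @id (Y i)).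

Definition zero_complex : complex A :=
  @Complex A (fun=> 'rV[A]_0) (fun _ _ => \0) (fun _ _ _ _ => erefl)
    (fun _ _ _ _ => erefl).

End Homotopy.

Definition projective (A : comNzRingType) (P : lmodType A) :=
  forall (V W : lmodType A) (g : {linear V -> W}) (f : {linear P -> W}),
    (forall w, exists v, g v = w) ->
    exists h : {linear P -> V}, forall x, g (h x) = f x.

Definition bounded_complex (A : comNzRingType) (X : complex A) :=
  exists n : nat, forall i : int, n%:Z < `|i| -> forall x : X i, x = 0.

(* the objects of K^b_f(proj A) *)
Definition perfect_finite_length (A : comNzRingType) (X : complex A) :=
  [/\ bounded_complex X,
      forall i, fin_gen (X i) /\ projective (X i) &
      forall i, finite_length (cohomology X i)].

Definition psi (A : comNzRingType) (I : idealr A) (M : lmodType A)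
    (X : complex A) (n : nat) : nat :=
  \sum_(i \in [set: int])
    length (cohomology (tensor_complex X (quotmod (pow_submod I M n))) i).

(* [f] is of polynomial type and its polynomial has degree [d]; recall that
   [size p] is one more than the degree of [p]. *)
Definition polynomial_type_degree (f : nat -> nat) (d : nat) :=
  exists p : {poly rat}, size p = d.+1 /\
    exists N, forall n, (N <= n)%N -> (f n)%:R = p.[n%:R].

(* Main.v *)
Require Import Defs.
From HB Require Import structures.
From mathcomp Require Import all_boot all_order all_algebra.
From mathcomp Require Import boolp classical_sets fsbigop.
From mathcomp Require Import zify ring lra freeg.

Set Implicit Arguments.
Unset Strict Implicit.
Unset Printing Implicit Defensive.

Import Order.TTheory GRing.Theory Num.Theory.
Local Open Scope classical_set_scope.
Local Open Scope ring_scope.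

(** Write d for the dimension of M, T for the complex X (x) M and D for its
    differential; T i, a quotient of a finite sum of copies of M, is finitely
    generated.  The cohomology of X (x) M/I^n M in degree i is U n/V n, where
    U n is the inverse image of I^n T (i+1) under D, and V n is the sum of
    I^n (T i) and the image of D ([cohomology_reduction_len]).  Lengths of such
    subquotients are suprema of chains of submodules of T i, so that no quotient
    has to be formed.

    Polynomial growth.  By Artin-Rees, U n = Z + I^(n-c) (U c) for large n,
    where Z is the kernel of D, and the lengths of T i/U n and T i/V n are
    Hilbert-Samuel functions up to a shift and a constant ([reduction_poly]).
    Artin-Rees and the polynomiality of Hilbert functions both come from the
    ascending chain condition for the Rees module ([rees_acc]).

    Upper bound d - 1.  The cohomology of X has finite length, hence for each a
    in m some power of a is null-homotopic on X ([null_homotopy]); so the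
    cohomology Z/B of T has finite length too.  The rest of U n/V n is a
    quotient of I^(n-c) (U c)/I^n (U c), whose length is a difference of values
    of a Hilbert-Samuel function of degree at most d ([reduction_growth]).

    Lower bound d - 1.  Contract X from the left as far as possible.  If X is
    not contractible, this stops at some degree i, with a cycle x modulo m that
    is part of a basis of a complement of the boundaries
    ([nonzero_obstruction]).  Tensoring with x embeds the socle of M/I^n M into
    the cohomology in degree i ([socle_cohomology]).  Up to a constant factor
    this socle is at least as long as I^(n-1) M/I^n M ([socle_bound]), whose
    length is a polynomial of degree d - 1.

    It remains to know that the Hilbert-Samuel polynomial of M has degree
    exactly d ([hilbert_samuel_degree]).  It is at least d because along a chain
    of primes the degree for A/P drops at each step ([prime_drop]); it is at
    most d by Noetherian induction on ideals ([chi_upper]). *)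

(** * Submodules and relative lengths *)

Section Submodules.
Variables (A : comNzRingType) (E : lmodType A).
Implicit Types (U V W : set E) (J : set A^o).

Definition subm W := W 0 /\ forall a x y, W x -> W y -> W (a *: x + y).

Lemma subm_closedE W : submod_closed (mem W) <-> subm W.
Proof.
split=> [[W0 WP]|[W0 WP]]; split; rewrite ?inE //.
- by move: W0; rewrite inE.
- by move=> a x y Wx Wy; have := WP a x y; rewrite !inE; apply.
by move=> a x y; rewrite !inE; exact: WP.
Qed.

Lemma subm0 W : subm W -> W 0. Proof. by case. Qed.

Lemma submD W x y : subm W -> W x -> W y -> W (x + y).
Proof. by move=> [_ WP] Wx Wy; rewrite -[x]scale1r; exact: WP. Qed.

Lemma submZ W a x : subm W -> W x -> W (a *: x).
Proof. by move=> [W0 WP] Wx; rewrite -[_ *: _]addr0; exact: WP. Qed.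

Lemma submN W x : subm W -> W x -> W (- x).
Proof. by move=> sW Wx; rewrite -scaleN1r; exact: submZ. Qed.

Lemma submB W x y : subm W -> W x -> W y -> W (x - y).
Proof. by move=> sW Wx Wy; apply: submD => //; exact: submN. Qed.

Lemma subm_setT : subm setT. Proof. by []. Qed.

Lemma subm_set1 : subm [set 0].
Proof. by split=> // a x y /= -> ->; rewrite scaler0 addr0. Qed.

Lemma submI U V : subm U -> subm V -> subm (U `&` V).
Proof.
move=> sU sV; split; first by split; exact: subm0.
by move=> a x y [Ux Vx] [Uy Vy]; split; apply: submD => //; exact: submZ.
Qed.

Definition addm U V : set E := [set x | exists2 u, U u & V (x - u)].

Lemma subm_add U V : subm U -> subm V -> subm (addm U V).
Proof.
move=> sU sV; split; first by exists 0; rewrite ?subr0; exact: subm0.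
move=> a x y [u Uu Vu] [w Uw Vw]; exists (a *: u + w).
  by apply: submD => //; exact: submZ.
rewrite opprD addrACA -scalerBr; apply: submD => //; exact: submZ.
Qed.

Lemma mem_addm U V u v : U u -> V v -> addm U V (u + v).
Proof. by move=> Uu Vv; exists u => //; rewrite addrC addKr. Qed.

Lemma addml U V : subm V -> U `<=` addm U V.
Proof. by move=> sV x Ux; exists x; rewrite ?subrr //; exact: subm0. Qed.

Lemma addmr U V : subm U -> V `<=` addm U V.
Proof. by move=> sU x Vx; exists 0; rewrite ?subr0 //; exact: subm0. Qed.

Lemma addm_sub U V W : subm W -> U `<=` W -> V `<=` W -> addm U V `<=` W.
Proof.
by move=> sW UW VW x [u Uu Vu]; rewrite -(subrK u x); apply: submD; auto.
Qed.

Inductive gspan (S : set E) : set E :=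
| gspan0 : gspan S 0
| gspanD a s x of S s & gspan S x : gspan S (a *: s + x).

Lemma subm_gspan S : subm (gspan S).
Proof.
split=> [|a x y Sx Sy]; first exact: gspan0.
elim: Sx => [|b s z Ss Sz IH]; first by rewrite scaler0 add0r.
by rewrite scalerDr scalerA -addrA; exact: gspanD.
Qed.

Lemma sub_gspan S : S `<=` gspan S.
Proof. by move=> x Sx; rewrite -[x]scale1r -[_ *: _]addr0; apply: gspanD => //; exact: gspan0. Qed.

Lemma gspan_sub S W : subm W -> S `<=` W -> gspan S `<=` W.
Proof.
move=> sW SW x; elim=> [|a s y /SW Ws _ Wy]; first exact: subm0.
by apply: submD => //; exact: submZ.
Qed.

Lemma gspanE (S : set E) x : (x \in Defs.span S) <-> gspan S x.
Proof.
split=> [/spanP xS|xS].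
  have /subm_closedE cW := subm_gspan S; set W := gspan S in cW *.
  have SW : S `<=` W by exact: sub_gspan.
  pose b := GRing.isSubmodClosed.Build A E (mem W) cW.
  pose W' := HB.pack_for (submodClosed E) (mem W : E -> bool) b.
  have xW : x \in W' by apply: xS => s /set_mem/SW Ws; exact: (mem_set Ws).
  exact: (set_mem xW).
apply/spanP => W SW; apply: (gspan_sub (W := [set` W])) xS; last first.
  by move=> s Ss; apply: SW; rewrite inE.
by split=> [|a u v uW vW] /=; [exact: rpred0|apply: rpredD => //; exact: rpredZ].
Qed.

Definition mulI J W : set E :=
  gspan [set x | exists a y, [/\ J a, W y & x = a *: y]].

Lemma subm_mulI J W : subm (mulI J W). Proof. exact: subm_gspan. Qed.

Lemma mem_mulI J W a y : J a -> W y -> mulI J W (a *: y).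
Proof. by move=> Ja Wy; apply: sub_gspan; exists a, y. Qed.

Lemma mulI_sub J W U :
  subm U -> (forall a y, J a -> W y -> U (a *: y)) -> mulI J W `<=` U.
Proof. by move=> sU JW; apply: gspan_sub => // _ [a [y [Ja Wy ->]]]; exact: JW. Qed.

Lemma mulIS J U W : U `<=` W -> mulI J U `<=` mulI J W.
Proof.
by move=> UW; apply: mulI_sub => [|a y Ja /UW]; [exact: subm_mulI|exact: mem_mulI].
Qed.

Lemma mulI_subr J W : subm W -> mulI J W `<=` W.
Proof. by move=> sW; apply: mulI_sub => // a y _ Wy; exact: submZ. Qed.

Definition powI J n W : set E := iter n (mulI J) W.

Lemma subm_powI J n W : subm W -> subm (powI J n W).
Proof. by case: n => // n _; exact: subm_mulI. Qed.

Lemma powIS J n U W : U `<=` W -> powI J n U `<=` powI J n W.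
Proof. by move=> UW; elim: n => //= n; exact: mulIS. Qed.

Lemma powI_sub J n W : subm W -> powI J n W `<=` W.
Proof.
move=> sW; elim: n => [//|n IH]; apply: subset_trans IH.
by apply: mulI_subr; exact: subm_powI.
Qed.

Lemma powI_leq J m n W : subm W -> (m <= n)%N -> powI J n W `<=` powI J m W.
Proof.
move=> sW /subnK <-; rewrite /powI iterD; apply: powI_sub; exact: subm_powI.
Qed.

Lemma powI_exp J n W a x : J a -> W x -> powI J n W (a ^+ n *: x).
Proof.
move=> Ja Wx; elim: n => [|n IH]; first by rewrite expr0 scale1r.
by rewrite exprS -scalerA; exact: mem_mulI.
Qed.

End Submodules.

#[global] Hint Resolve subm_mulI subm_setT subm_set1 subm_gspan : core.

Section SubmodulesMap.
Variables (A : comNzRingType) (E F : lmodType A) (f : {linear E -> F}).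
Implicit Types (U : set E) (V : set F) (J : set A^o).

Lemma subm_im U : subm U -> subm (f @` U).
Proof.
move=> sU; split; first by exists 0; rewrite ?raddf0 //; exact: subm0.
move=> a _ _ [x Ux <-] [y Uy <-]; exists (a *: x + y); last by rewrite linearP.
by apply: submD => //; exact: submZ.
Qed.

Lemma subm_preim V : subm V -> subm (f @^-1` V).
Proof.
move=> sV; split; first by rewrite /= raddf0; exact: subm0.
by move=> a x y Vx Vy; rewrite /= linearP; apply: submD => //; exact: submZ.
Qed.

Lemma powI_map J n U V x :
  (forall u, U u -> V (f u)) -> powI J n U x -> powI J n V (f x).
Proof.
move=> UV; elim: n x => [|n IH] x /=; first exact: UV.
move=> Ux; pose S := f @^-1` mulI J (powI J n V).
suff: S x by [].
apply: mulI_sub Ux => [|a y Ja Uy]; first exact: subm_preim.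
by rewrite /S /= linearZ; apply: mem_mulI => //; exact: IH.
Qed.

Lemma powI_lift J n U V x :
  subm U -> (forall v, V v -> exists2 u, U u & f u = v) ->
  powI J n V x -> exists2 u, powI J n U u & f u = x.
Proof.
move=> sU UV; elim: n x => [|n IH] x /=; first exact: UV.
apply: (mulI_sub (U := f @` mulI J (powI J n U))); first exact/subm_im.
move=> a y Ja /IH[u Uu <-]; exists (a *: u); last by rewrite linearZ.
exact: mem_mulI.
Qed.

End SubmodulesMap.

Section Lengths.
Variables (A : comNzRingType).

(** The submodules of the quotient U/V, without forming it; [len] and [fin]
    speak of its length. *)
Definition interval (E : lmodType A) (V U : set E) : set (set E) :=
  [set W | [/\ subm W, V `<=` W & W `<=` U]].

Definition len (E : lmodType A) (V U : set E) : nat :=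
  nat_sup (chain_lengths (interval V U)).

Definition fin (E : lmodType A) (V U : set E) : Prop :=
  exists n, forall k, chain_lengths (interval V U) k -> (k <= n)%N.

Lemma nat_sup_max (P : set nat) n0 : P n0 ->
  (exists n, forall k, P k -> (k <= n)%N) ->
  P (nat_sup P) /\ forall k, P k -> (k <= nat_sup P)%N.
Proof.
move=> Pn0 [n Pn].
suff ex : exists n, P n /\ forall k, P k -> (k <= n)%N by exact: (xgetPex 0%N ex).
have [k /asboolP Pk kmax] := @ex_maxnP (fun k => `[< P k >]) n
  (ex_intro (fun k => `[< P k >]) n0 (asboolT Pn0)) (fun k Pk => Pn k (asboolW Pk)).
by exists k; split => // i Pi; apply: kmax; exact/asboolP.
Qed.

Section OneModule.
Variable E : lmodType A.
Implicit Types (U V W : set E).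

Lemma chain0 V U : subm V -> V `<=` U -> chain_lengths (interval V U) 0%N.
Proof. by move=> sV VU; exists (fun=> V); split=> // i _; split. Qed.

Lemma lenP V U : subm V -> V `<=` U -> fin V U ->
  chain_lengths (interval V U) (len V U) /\
  forall k, chain_lengths (interval V U) k -> (k <= len V U)%N.
Proof. by move=> sV VU; apply: nat_sup_max; exact: chain0. Qed.

Lemma len_max V U k : subm V -> V `<=` U -> fin V U ->
  chain_lengths (interval V U) k -> (k <= len V U)%N.
Proof. by move=> sV VU fVU; case: (lenP sV VU fVU) => _; apply. Qed.

Lemma len_leq V U n : subm V -> V `<=` U ->
  (forall k, chain_lengths (interval V U) k -> (k <= n)%N) ->
  fin V U /\ (len V U <= n)%N.
Proof.
move=> sV VU Hn; have fVU : fin V U by exists n.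
by split=> //; apply: Hn; case: (lenP sV VU fVU).
Qed.

End OneModule.

(** An order embedding carries chains to chains. *)
Lemma len_embed (E F : lmodType A) (V U : set E) (V' U' : set F)
    (phi : set E -> set F) : subm V -> V `<=` U -> subm V' -> V' `<=` U' ->
  (forall W, interval V U W -> interval V' U' (phi W)) ->
  (forall W1 W2, interval V U W1 -> interval V U W2 -> W1 `<` W2 ->
     phi W1 `<` phi W2) ->
  fin V' U' -> fin V U /\ (len V U <= len V' U')%N.
Proof.
move=> sV VU sV' VU' phiI phiS fin'; apply: len_leq => // k [F0 [F0I F0S]].
apply: len_max => //; exists (phi \o F0); split=> i ik /=; first exact/phiI/F0I.
by apply: phiS; [apply: F0I; exact: ltnW|exact: F0I|exact: F0S].
Qed.

(** Here f induces an injection of U/V into U'/V'; submodules are carried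
    forward by taking images. *)
Lemma len_inj (E F : lmodType A) (f : {linear E -> F}) (V U : set E)
    (V' U' : set F) : subm V -> V `<=` U -> subm V' -> subm U' -> V' `<=` U' ->
  subm U ->
  (forall u, U u -> V' (f u) -> V u) -> (forall u, U u -> U' (f u)) ->
  fin V' U' -> fin V U /\ (len V U <= len V' U')%N.
Proof.
move=> sV VU sV' sU' VU' sU fV fU.
apply: (@len_embed _ _ _ _ _ _ (fun W => addm (f @` W) V')) => //.
  move=> W [sW VW WU]; split.
  - by apply: subm_add => //; exact: subm_im.
  - by apply: addmr; exact: subm_im.
  - by apply: addm_sub => // _ [w /WU /fU ? <-].
move=> W1 W2 [s1 V1 U1] [s2 V2 U2] [W12 W21]; split.
  by move=> x [_ [w W1w <-] V'x]; exists (f w) => //; exists w => //; exact: W12.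
apply: contra_not W21 => W21 u W2u.
have [|_ [w W1w <-] V'x] := W21 (f u); first by apply: addml => //; exists u.
rewrite -raddfB /= in V'x; rewrite -(subrK w u); apply: submD => //.
by apply/V1/fV => //; apply: submB => //; [exact: U2|exact: U1].
Qed.

(** Here f induces a surjection of a submodule of U/V onto U'/V'; submodules are
    carried back by taking inverse images. *)
Lemma len_surj (E F : lmodType A) (f : {linear E -> F}) (V U : set E)
    (V' U' : set F) : subm V -> V `<=` U -> subm V' -> subm U' -> V' `<=` U' ->
  subm U ->
  (forall v, V v -> V' (f v)) ->
  (forall u', U' u' -> exists2 u, U u & V' (u' - f u)) ->
  fin V U -> fin V' U' /\ (len V' U' <= len V U)%N.
Proof.
move=> sV VU sV' sU' VU' sU fV fU.
apply: (@len_embed _ _ _ _ _ _ (fun W => U `&` (f @^-1` W))) => //.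
  move=> W [sW VW WU]; split.
  - by apply: submI => //; exact: subm_preim.
  - by move=> v Vv; split; [exact: VU|exact/VW/fV].
  - by move=> ? [].
move=> W1 W2 [s1 V1 U1] [s2 V2 U2] [W12 W21]; split.
  by move=> x [Ux W1x]; split=> //; exact: W12.
apply: contra_not W21 => W21 w W2w; have [u Uu V'u] := fU _ (U2 _ W2w).
rewrite -(subrK (f u) w); apply: submD => //; first exact: V1.
have [|//] := W21 u; split=> //=.
by rewrite -[f u](subKr w); apply: submB => //; exact: V2.
Qed.

Section OneModuleLength.
Variable E : lmodType A.
Implicit Types (U V W : set E).

Let chain_snoc V W U k : subm U -> V `<=` U -> W `<` U ->
  chain_lengths (interval V W) k -> chain_lengths (interval V U) k.+1.
Proof.
move=> sU VU [WU UW] [F [FI FS]].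
exists (fun i => if (i <= k)%N then F i else U); split=> i; rewrite leq_eqVlt.
  case: eqP => [-> _|_]; first by rewrite ltnn; split.
  rewrite ltnS /= => ik; rewrite ik; case: (FI i ik) => sF VF FW.
  by split=> //; exact: subset_trans WU.
rewrite eqSS ltnS; case: eqP => [-> _|_]; last first.
  by move=> /= ik; rewrite ik ltnW //; exact: FS.
rewrite leqnn ltnn; have [_ _ FW] := FI k (leqnn k); split.
  exact: subset_trans FW WU.
by apply: contra_not UW => /subset_trans; exact.
Qed.

Lemma interval_sub V V' U U' : V' `<=` V -> U `<=` U' ->
  interval V U `<=` interval V' U'.
Proof.
by move=> V'V UU' W [sW VW WU]; split=> //; [exact: subset_trans VW|exact: subset_trans UU'].
Qed.

Lemma chain_sub (C D : set (set E)) : C `<=` D -> chain_lengths C `<=` chain_lengths D.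
Proof. by move=> CD k [F [FC FS]]; exists F; split=> // i ik; apply/CD/FC. Qed.

Lemma fin_sub V V' U U' : V' `<=` V -> U `<=` U' -> fin V' U' -> fin V U.
Proof.
move=> V'V UU' [n Hn]; exists n => k Ck; apply: Hn.
by apply: chain_sub Ck; exact: interval_sub.
Qed.

Lemma len_sub V V' U U' : subm V -> subm V' -> V' `<=` V -> V `<=` U -> U `<=` U' ->
  fin V' U' -> (len V U <= len V' U')%N.
Proof.
move=> sV sV' V'V VU UU' f'; have fVU := fin_sub V'V UU' f'.
apply: len_max => //; first exact: subset_trans (subset_trans VU UU').
by case: (lenP sV VU fVU) => + _; apply: chain_sub; exact: interval_sub.
Qed.

Let len_ltr V W U : subm V -> subm U -> V `<=` W -> W `<` U -> fin V U ->
  (len V W < len V U)%N.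
Proof.
move=> sV sU VW WU fVU.
have fVW : fin V W by apply: fin_sub fVU => //; case: WU.
have VU : V `<=` U by case: WU => + _; exact: subset_trans.
by apply: len_max => //; case: (lenP sV VW fVW) => + _; exact: chain_snoc.
Qed.

Let strict_leq (g : nat -> nat) n : (forall i, (i < n)%N -> (g i < g i.+1)%N) ->
  (n <= g n)%N.
Proof. by elim: n => // n IH gS; apply: leq_ltn_trans (gS n _); rewrite ?IH // => i /ltnW/gS. Qed.

Lemma chain_cat V W U k l : V `<=` W -> W `<=` U ->
  chain_lengths (interval V W) k -> chain_lengths (interval W U) l ->
  chain_lengths (interval V U) (k + l).
Proof.
move=> VW WU [F [FI FS]] [G [GI GS]].
exists (fun i => if (i < k)%N then F i else G (i - k)%N); split=> i.
  case: ltnP => [ik _|ki]; first by apply: interval_sub (FI i (ltnW ik)).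
  by rewrite -leq_subLR => il; apply: interval_sub (GI _ il).
case: (ltnP i k) => [ik _|ki]; last first.
  move=> il; rewrite [(i.+1 < k)%N]ltnNge leqW //= subSn //; apply: GS.
  by rewrite ltn_subLR.
case: ltnP => [ik1|ki1]; first exact: FS.
have ek : k = i.+1 by apply/eqP; rewrite eqn_leq ki1.
rewrite -ek subnn; have [GW WG _] := GI 0%N (leq0n _).
have [FF FF'] := FS i ik; rewrite -ek in FF FF'; have [_ _ FW] := FI k (leqnn k).
split; first by apply: subset_trans WG; apply: subset_trans FW.
by apply: contra_not FF' => GF; apply: subset_trans FW _; apply: subset_trans GF.
Qed.

(** Intersect the members of a chain from V to W with U, and add U to them.  By
    the modular law, at each strict step one of the two results grows; so the
    sum of their lengths over V and over U bounds the number of steps. *)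
Lemma len_add V U W : subm V -> subm U -> subm W -> V `<=` U -> U `<=` W ->
  fin V U -> fin U W -> fin V W /\ len V W = (len V U + len U W)%N.
Proof.
move=> sV sU sW VU UW fVU fUW; have VW := subset_trans VU UW.
have [] := @len_leq E V W (len V U + len U W)%N => //.
  move=> n [F [FI FS]].
  pose g i := (len V (F i `&` U) + len U (addm (F i) U))%N.
  have gmax i : (i <= n)%N -> (g i <= len V U + len U W)%N.
    move=> /FI[sF VF FW]; apply: leq_add; apply: len_sub => //.
    - by move=> x Vx; split; [exact: VF|exact: VU].
    - exact: addmr.
    - exact: addm_sub.
  apply: leq_trans (gmax n (leqnn n)); apply: strict_leq => i ik.
  have [sF VF FW] := FI i (ltnW ik); have [sF' VF' FW'] := FI i.+1 ik.
  have [FF FF'] := FS i ik.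
  have VI : V `<=` F i `&` U by move=> x Vx; split; [exact: VF|exact: VU].
  have II : F i `&` U `<=` F i.+1 `&` U by move=> x [/FF].
  have UA : U `<=` addm (F i) U by exact: addmr.
  have AA : addm (F i) U `<=` addm (F i.+1) U.
    by move=> x [u /FF Fu Ux]; exists u.
  have fI : fin V (F i.+1 `&` U) by apply: fin_sub fVU.
  have fA : fin U (addm (F i.+1) U).
    by apply: fin_sub fUW => //; exact: addm_sub.
  have [eqI|neI] := pselect (F i.+1 `&` U `<=` F i `&` U); last first.
    rewrite /g -addSn; apply: leq_add; last by apply: len_sub.
    by apply: len_ltr => //; exact: submI.
  rewrite /g -addnS; apply: leq_add; first by apply: len_sub.
  apply: len_ltr => //; first exact: subm_add.
  split=> //; apply: contra_not FF' => A'A x F'x.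
  have [|u Fu Ux] := A'A x; first exact: addml.
  rewrite -(subrK u x); apply: submD => //.
  by case: (eqI (x - u)) => //; split=> //; apply: submB => //; exact: FF.
move=> fVW le; split=> //; apply/eqP; rewrite eqn_leq le /=.
apply: len_max => //; have [cVU _] := lenP sV VU fVU; have [cUW _] := lenP sU UW fUW.
exact: chain_cat cVU cUW.
Qed.

Lemma len_eq0 V U : subm V -> subm U -> V `<=` U -> fin V U -> len V U = 0%N -> U `<=` V.
Proof.
move=> sV sU VU fVU l0; have [//|nUV] := pselect (U `<=` V).
have := @len_ltr V V U sV sU (@subset_refl _ V) (conj VU nUV) fVU.
by rewrite l0 ltn0.
Qed.

Lemma len_refl V : subm V -> fin V V /\ len V V = 0%N.
Proof.
move=> sV; have [//||fVV] := @len_leq E V V 0 sV; last by rewrite leqn0 => /eqP.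
move=> [//|k] [F [FI FS]]; have [_ []] := FS 0%N (ltn0Sn _).
have [_ VF0 _] := FI 0%N (leq0n _); have [_ _ F1V] := FI 1%N (ltn0Sn _).
exact: subset_trans VF0.
Qed.

Lemma fin_refl V : subm V -> fin V V. Proof. by case/len_refl. Qed.

Lemma fin_dcc V (W : nat -> set E) : (forall n, subm (W n)) ->
  (forall n, V `<=` W n) -> (forall n, W n.+1 `<=` W n) -> fin V (W 0%N) ->
  exists n, W n `<=` W n.+1.
Proof.
move=> sW VW WS [n Hn]; apply: contrapT => nW; have := Hn n.+1; rewrite ltnn.
move=> H; suff: false by []; apply: H; exists (fun i => W (n.+1 - i)%N); split=> i ik.
  split=> //; elim: (n.+1 - i)%N => // j IH; exact: subset_trans (WS j) IH.
rewrite subSS subSn //; split; first exact: WS.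
by move=> H; apply: nW; exists (n - i)%N.
Qed.

End OneModuleLength.
End Lengths.

(** * Chain conditions, local rings and modules of finite length *)

Section Acc.
Variable T : Type.
Implicit Types (C : set (set T)).

Definition acc C := forall F : nat -> set T, (forall n, C (F n)) ->
  (forall n, F n `<=` F n.+1) -> exists N, forall n, (N <= n)%N -> F n `<=` F N.

Lemma chain_mono (F : nat -> set T) : (forall n, F n `<=` F n.+1) ->
  forall m n, (m <= n)%N -> F m `<=` F n.
Proof.
move=> FS m n /subnK <-; elim: (n - m)%N => [//|k IH]; exact: subset_trans (FS _).
Qed.

(** Noetherian induction; a failure would start an infinite ascending chain. *)
Lemma acc_ind C (P : set T -> Prop) : acc C ->
  (forall W, C W -> (forall W', C W' -> W `<=` W' -> ~ W' `<=` W -> P W') -> P W) ->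
  forall W, C W -> P W.
Proof.
move=> accC IH W0 CW0; apply: contrapT => nP0.
pose X := {W : set T | C W /\ ~ P W}.
have step (w : X) : exists w' : X, sval w `<=` sval w' /\ ~ sval w' `<=` sval w.
  case: w => W [CW nPW] /=; apply: contrapT => nW; apply/nPW/IH => // W' CW' WW' W'W.
  by apply: contrapT => nPW'; apply: nW; exists (exist _ W' (conj CW' nPW')).
have [g gP] := choice step.
pose F n := sval (iter n g (exist _ W0 (conj CW0 nP0))).
have [N NP] : exists N, forall n, (N <= n)%N -> F n `<=` F N.
  apply: accC => n; rewrite /F; first by case: (iter _ _ _) => W [].
  by rewrite iterS; case: (gP (iter n g (exist _ W0 (conj CW0 nP0)))).
have [_] := gP (iter N g (exist _ W0 (conj CW0 nP0))); apply.
by rewrite -iterS; exact: NP.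
Qed.

Lemma acc_max C (P : set T -> Prop) W0 : acc C -> C W0 -> P W0 ->
  exists W, [/\ C W, P W & forall W', C W' -> P W' -> W `<=` W' -> W' `<=` W].
Proof.
move=> accC CW0 PW0; apply: contrapT => nmax.
suff : forall W, C W -> ~ P W by move/(_ W0 CW0).
apply: (acc_ind accC) => W CW IH PW; apply: nmax; exists W; split=> // W' CW' PW' WW'.
by apply: contrapT => W'W; exact: (IH W').
Qed.

(** A doubly increasing family stabilises in its second index uniformly in the
    first one: beyond some diagonal entry nothing moves, and only finitely
    many rows lie below it. *)
Lemma acc2 C (L : nat -> nat -> set T) : acc C -> (forall j k, C (L j k)) ->
  (forall j k, L j k `<=` L j.+1 k) -> (forall j k, L j k `<=` L j k.+1) ->
  exists K, forall j k, (K <= k)%N -> L j k `<=` L j K.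
Proof.
move=> accC CL L1 L2.
have mono j k j' k' : (j <= j')%N -> (k <= k')%N -> L j k `<=` L j' k'.
  move=> jj kk; apply: (@subset_trans _ (L j' k)); last exact: chain_mono kk.
  exact: (@chain_mono (L^~ k)).
have [J JP] := accC (fun j => L j j) (fun j => CL j j)
  (fun j => subset_trans (L1 j j) (L2 j.+1 j)).
have rows n : exists K, forall j k, (j < n)%N -> (K <= k)%N -> L j k `<=` L j K.
  elim: n => [|n [K KP]]; first by exists 0%N.
  have [K' K'P] := accC (L n) (CL n) (L2 n).
  exists (maxn K K') => j k; rewrite ltnS leq_eqVlt geq_max => /orP[/eqP->|jn] /andP[Kk Kk'].
    by apply: subset_trans (K'P _ Kk') _; apply: mono => //; exact: leq_maxr.
  by apply: subset_trans (KP _ _ jn Kk) _; apply: mono => //; exact: leq_maxl.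
have [K KP] := rows J; exists (maxn J K) => j k; rewrite geq_max => /andP[Jk Kk].
case: (ltnP j J) => jJ.
  by apply: subset_trans (KP _ _ jJ Kk) _; apply: mono => //; exact: leq_maxr.
apply: (@subset_trans _ (L (maxn j k) (maxn j k))).
  by apply: mono; [exact: leq_maxl|exact: leq_maxr].
apply: subset_trans (JP _ _) _; first by rewrite leq_max jJ.
by apply: mono => //; exact: leq_maxl.
Qed.

End Acc.

Section ScaleBy.
Variables (A : comNzRingType) (E : lmodType A) (w : E).

Definition scale_by (a : A^o) : E := (a : A) *: w.

Lemma scale_by_linear : linear scale_by.
Proof. by move=> a x y; rewrite /scale_by scalerDl scalerA. Qed.

HB.instance Definition _ := GRing.isLinear.Build A A^o E *:%R scale_by scale_by_linear.

End ScaleBy.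

Section Homothety.
Variables (A : comNzRingType) (E : lmodType A) (a : A).

Definition homothety (x : E) : E := a *: x.

Lemma homothety_linear : linear homothety.
Proof. by move=> b x y; rewrite /homothety scalerDr !scalerA mulrC. Qed.

HB.instance Definition _ := GRing.isLinear.Build A E E *:%R homothety homothety_linear.

End Homothety.

Section Noetherian.
Variable A : comNzRingType.

Definition noeth (E : lmodType A) := acc [set W : set E | subm W].

Lemma noetherian_gens (J : set A^o) : noetherian A -> subm J ->
  exists s : seq A^o, forall a, J a <-> gspan [set` s] a.
Proof.
move=> noethA sJ.
have cJ : submod_closed (mem J) by apply/subm_closedE.
pose b := GRing.isSubmodClosed.Build A A^o (mem J) cJ.
pose J' := HB.pack_for (submodClosed A^o) (mem J : A^o -> bool) b.
have [s sE] := noethA J'; exists s => a.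
split=> [Ja|/gspanE]; first by apply/gspanE; rewrite sE; exact: (mem_set Ja).
by rewrite sE => aJ; exact: (set_mem aJ).
Qed.

Lemma noeth_ring : noetherian A -> noeth A^o.
Proof.
move=> noethA F sF FS.
pose J := [set a | exists n, F n a].
have sJ : subm J.
  split=> [|a x y [i Fx] [j Fy]]; first by exists 0%N; exact: (subm0 (sF _)).
  have sM := sF (maxn i j).
  exists (maxn i j); apply: (submD sM); [apply: (submZ _ sM)|].
    exact: (chain_mono FS (leq_maxl _ _) Fx).
  exact: (chain_mono FS (leq_maxr _ _) Fy).
have [s memJ] := noetherian_gens noethA sJ.
have [N NP] : exists N, forall x, x \in s -> F N x.
  have : forall x, x \in s -> J x.
    by move=> x xs; apply/memJ; exact: (@sub_gspan _ _ [set` s]).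
  elim: (s : seq A) => [|x t IH] tJ; first by exists 0%N.
  have [|N NP] := IH; first by move=> y yt; apply: tJ; rewrite inE yt orbT.
  have [|n Fx] := tJ x; first by rewrite inE eqxx.
  exists (maxn n N) => y; rewrite inE => /orP[/eqP->|/NP Fy].
    exact: (chain_mono FS (leq_maxl _ _) Fx).
  exact: (chain_mono FS (leq_maxr _ _) Fy).
exists N => n _ a Fa; have /memJ : J a by exists n.
by apply: gspan_sub => //; exact: sF.
Qed.

Lemma gspan_cons (E : lmodType A) (e : E) (s : seq E) x :
  gspan [set` e :: s] x -> exists a, gspan [set` s] (x - a *: e).
Proof.
apply: (gspan_sub (W := [set x | exists a, gspan [set` s] (x - a *: e)])).
  split=> [|a y z [b yb] [c zc]]; first by exists 0; rewrite scale0r subr0; exact: (subm0 (subm_gspan _)).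
  exists (a * b + c); rewrite scalerDl -scalerA opprD addrACA -scalerBr.
  exact: (submD (subm_gspan _) (submZ a (subm_gspan _) yb) zc).
move=> y; rewrite /= inE => /orP[/eqP->|ys].
  by exists 1; rewrite scale1r subrr; exact: (subm0 (subm_gspan _)).
by exists 0; rewrite scale0r subr0; exact: (@sub_gspan _ _ [set` s]).
Qed.

(** Drop one generator e at a time.  A submodule F of A e + E' is determined by
    its intersection with E' and by the ideal of coefficients of e in F, provided
    that one of the two submodules compared contains the other. *)
Lemma noeth_fin_gen (E : lmodType A) : noeth A^o -> fin_gen E -> noeth E.
Proof.
move=> noethA [s sE].
have sT x : gspan [set` s] x by apply/gspanE; rewrite sE.
suff: acc [set W : set E | subm W /\ W `<=` gspan [set` s]].
  by move=> accs F sF FS; apply: accs FS => n; split=> [|x _]; [exact: sF|exact: sT].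
elim: (s : seq E) => [|e t IH] F /= CF FS.
  exists 0%N => n _ x /(proj2 (CF n)) x0; have sF := proj1 (CF 0%N).
  by apply: (gspan_sub sF _ x0) => y.
have sF n := proj1 (CF n).
pose L k : set A^o := [set a | exists2 u, gspan [set` t] u & F k ((a : A) *: e + u)].
have sL k : subm (L k).
  split=> [|a b c [u tu Fu] [v tv Fv]].
    by exists 0; rewrite ?scale0r ?addr0; exact: subm0.
  exists (a *: u + v); first exact: (submD (subm_gspan _) (submZ a (subm_gspan _) tu) tv).
  rewrite scalerDl -scalerA addrACA -scalerDr; apply: submD => //; exact: submZ.
have [N1 N1P] := noethA L sL (fun k a '(ex_intro2 u tu Fu) => ex_intro2 _ _ u tu (FS _ _ Fu)).
have [N2 N2P] := IH (fun k => F k `&` gspan [set` t])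
  (fun k => conj (submI (sF k) (subm_gspan _)) (@subIsetr _ _ _))
  (fun k => @setSI _ _ _ _ (FS k)).
exists (maxn N1 N2) => n; rewrite geq_max => /andP[N1n N2n] x Fx.
have FN k : (k <= maxn N1 N2)%N -> F k `<=` F (maxn N1 N2) by exact: chain_mono.
have Fnn : F (maxn N1 N2) `<=` F n by apply: chain_mono => //; rewrite geq_max N1n.
have [a ta] := gspan_cons (proj2 (CF n) x Fx).
have [|u tu Fu] := N1P n N1n a; first by exists (x - a *: e); rewrite // subrKC.
have /(FN N1 (leq_maxl _ _)) FuN := Fu.
rewrite -(subrK (a *: e + u) x); apply: submD => //.
have [|] := N2P n N2n (x - (a *: e + u)); last by move=> /(FN N2 (leq_maxr _ _)).
split; first by apply: submB => //; exact: Fnn.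
by rewrite opprD addrA; apply: submB.
Qed.

End Noetherian.

Section Local.
Variables (A : comNzRingType) (m : idealr A).
Hypotheses (noethA : noeth A^o) (A_local : local_ring m).

Definition mset (I : idealr A) : set A^o := [set a | a \in I].

Lemma subm_mset (I : idealr A) : subm (mset I).
Proof.
split=> [|a x y]; rewrite /mset /=; first exact: rpred0.
by move=> xI yI; apply: rpredD => //; exact: idealMr.
Qed.

Lemma idealr_of (J : set A^o) : subm J -> ~ J 1 ->
  exists J' : idealr A, forall a, a \in J' <-> J a.
Proof.
move=> sJ nJ1.
have cJ : idealr_closed (mem J : {pred A}).
  split=> [||a x y /set_mem Jx /set_mem Jy]; [exact/mem_set/(subm0 sJ)|by apply/negP => /set_mem|].
  exact/mem_set/(submD sJ (submZ a sJ Jx) Jy).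
pose b := isIdealr.Build A (mem J : A -> bool) cJ.
pose J' := HB.pack_for (idealr A) (mem J : A -> bool) b.
by exists J' => a; split=> [aJ|Ja]; [exact: (set_mem aJ)|exact: (mem_set Ja)].
Qed.

Lemma mset1 (I : idealr A) : ~ mset I 1.
Proof. by rewrite /mset /= => /negP; apply; rewrite idealr1. Qed.

(** A proper ideal lies in a maximal one, and m is the only maximal ideal. *)
Lemma proper_sub_m (J : set A^o) : subm J -> ~ J 1 -> J `<=` mset m.
Proof.
move=> sJ nJ1.
have [M [sM [nM1 JM] Mmax]] := @acc_max _ _ (fun W => ~ W 1 /\ J `<=` W) J noethA sJ
  (conj nJ1 (@subset_refl _ J)).
have [M' M'E] := idealr_of sM nM1.
have maxM' : maximal_ideal M'.
  move=> K M'K x; apply/idP/idP => [xK|/M'K//]; apply/M'E.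
  apply: (Mmax (mset K)) => //; [exact: subm_mset| |].
    by split=> [|a Ja]; [exact: mset1|apply/M'K/M'E/JM].
  by move=> a /M'E/M'K.
by move=> a /JM/M'E; rewrite (proj2 A_local M' maxM').
Qed.

Lemma unit_notin_m a : a \notin m -> exists b, b * a = 1.
Proof.
move=> am; apply: contrapT => na; move/negP: am; apply.
apply: (@proper_sub_m (scale_by (a : A^o) @` setT)); first exact: subm_im.
  by move=> [b _ ba]; apply: na; exists b.
by exists 1 => //; rewrite /scale_by scale1r.
Qed.

Lemma m_prime a b : a * b \in m -> a \in m \/ b \in m.
Proof.
move=> abm; have [am|/unit_notin_m[c ca]] := boolP (a \in m); [by left|right].
by rewrite -[b]mul1r -ca -mulrA; exact: idealMr.
Qed.

(** If K were larger than W, a maximal proper submodule V of K above W would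
    give a nonzero cyclic module K/V = A k with m (K/V) = K/V. *)
Lemma nakayama (E : lmodType A) (W K : set E) : noeth E -> subm W -> subm K ->
  W `<=` K -> K `<=` addm W (mulI (mset m) K) -> K `<=` W.
Proof.
move=> noethE sW sK WK KWmK; apply: contrapT => nKW.
have [V [sV [VK nKV WV] Vmax]] := @acc_max _ _
  (fun V => [/\ V `<=` K, ~ K `<=` V & W `<=` V]) W noethE sW (And3 WK nKW (@subset_refl _ W)).
have [k Kk nVk] : exists2 k, K k & ~ V k.
  by apply: contrapT => nk; apply: nKV => k Kk; apply: contrapT => nVk; apply: nk; exists k.
pose V' := addm V (scale_by k @` setT).
have sk : subm (scale_by k @` setT) by exact: subm_im.
have sV' : subm V' by exact: subm_add.
have KV' : K `<=` V'.
  apply: contrapT => nKV'; apply: nVk; apply: (Vmax V') => //.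
  - split=> //; last by apply: subset_trans WV _; exact: addml.
    by apply: addm_sub => // _ [a _ <-]; exact: submZ.
  - exact: addml.
  - by apply: addmr => //; exists 1 => //; rewrite /scale_by scale1r.
have : addm V (scale_by k @` mset m) k.
  have sm : subm (scale_by k @` mset m) by apply: subm_im; exact: subm_mset.
  suff sub : addm W (mulI (mset m) K) `<=` addm V (scale_by k @` mset m).
    exact/sub/KWmK.
  apply: addm_sub; first exact: subm_add.
    by apply: subset_trans WV _; exact: addml.
  apply: mulI_sub; first exact: subm_add.
  move=> a y ma /KV'[v Vv [b _ bE]]; exists (a *: v); first exact: submZ.
  exists (a * b); first by rewrite /mset /= mulrC; exact: idealMr.
  by rewrite -scalerBr -bE /scale_by scalerA.
move=> [v Vv [a ma ak]]; apply: nVk.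
have [|b ba1] := @unit_notin_m (1 - a).
  apply/negP => m1a; have := rpredD m1a ma; rewrite subrK; exact: (@mset1 m).
rewrite -[k]scale1r -ba1 -scalerA scalerBl scale1r; apply: submZ => //.
by rewrite -[a *: k]/(scale_by k a) ak subKr.
Qed.

Lemma fin_residue : fin (mset m) [set: A^o].
Proof.
exists 1%N => -[|[|k]] // [F [FI FS]]; exfalso.
have [sF0 mF0 _] := FI 0%N (leq0n _); have [sF1 _ _] := FI 1%N isT.
have [_ F10] := FS 0%N isT; have [_ F21] := FS 1%N isT.
apply: F10 => a F1a; apply: mF0; apply: contrapT => /negP/unit_notin_m[b ba].
apply: F21 => c _; rewrite -[c]mulr1 -ba mulrA.
exact: (submZ (c * b) sF1).
Qed.

(** Take w with annihilator modulo W as large as possible.  If a is in m but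
    does not kill w, then a w has the same annihilator, and inductively no
    power of a kills w. *)
Lemma torsion_socle (E : lmodType A) (W U : set E) u : subm W -> subm U ->
  (forall a, a \in m -> exists n, forall u, U u -> W (a ^+ n *: u)) ->
  U u -> ~ W u -> exists w, [/\ U w, ~ W w & forall a, a \in m -> W (a *: w)].
Proof.
move=> sW sU tors Uu nWu.
pose ann (w : E) : set A^o := scale_by w @^-1` W.
have sann w : subm (ann w) by exact: subm_preim.
have [J [_ [w [Uw nWw ->]] Jmax]] := @acc_max _ _
  (fun J => exists w, [/\ U w, ~ W w & J = ann w]) (ann u) noethA (sann u)
  (ex_intro _ u (And3 Uu nWu erefl)).
exists w; split=> // a ma; apply: contrapT => naw; have [n /(_ w Uw)] := tors a ma.
elim: n => [|n IH]; first by rewrite expr0 scale1r.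
rewrite exprS => Wn; apply: IH; apply: contrapT => nn.
apply: naw; apply: (Jmax (ann (a ^+ n *: w))) => //.
- exact: sann.
- by exists (a ^+ n *: w); split=> //; exact: submZ.
- move=> b; rewrite /ann /= /scale_by => Wb.
  by rewrite scalerA mulrC -scalerA; exact: submZ.
- by rewrite /ann /= /scale_by scalerA.
Qed.

(** Enlarge a maximal W with U/W of infinite length by an element killed by m
    modulo W: this adds one step only. *)
Lemma fin_torsion (E : lmodType A) (V U : set E) : noeth E -> subm V -> subm U ->
  V `<=` U -> (forall a, a \in m -> exists n, forall u, U u -> V (a ^+ n *: u)) ->
  fin V U.
Proof.
move=> noethE sV sU VU tors; apply: contrapT => nfin.
have [W [sW [VW WU nW] Wmax]] := @acc_max _ _
  (fun W => [/\ V `<=` W, W `<=` U & ~ fin W U]) V noethE sV (And3 (@subset_refl _ V) VU nfin).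
have [u Uu nWu] : exists2 u, U u & ~ W u.
  apply: contrapT => nu; apply: nW.
  have -> : W = U by apply/seteqP; split=> // x Ux; apply: contrapT => nWx; apply: nu; exists x.
  exact: fin_refl.
have torsW a : a \in m -> exists n, forall u, U u -> W (a ^+ n *: u).
  by move=> /tors[n nP]; exists n => v /nP/VW.
have [w [Uw nWw mw]] := torsion_socle sW sU torsW Uu nWu.
pose W' := addm W (scale_by w @` setT).
have sw : subm (scale_by w @` setT) by exact: subm_im.
have sW' : subm W' by exact: subm_add.
have WW' : W `<=` W' by exact: addml.
have W'U : W' `<=` U by apply: addm_sub => // _ [a _ <-]; exact: submZ.
have fW' : fin W' U.
  apply: contrapT => nW'; apply: nWw; apply: (Wmax W') => //.
    by split=> //; exact: subset_trans WW'.
  by apply: addmr => //; exists 1 => //; rewrite /scale_by scale1r.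
have fWW' : fin W W'.
  have [] := @len_surj _ _ _ (scale_by w) (mset m) setT W W' => //; try exact: subm_mset.
    by move=> x [v Wv [a _ aE]]; exists a => //=; rewrite aE subKr.
  exact: fin_residue.
by apply: nW; case: (len_add sW sW' sU WW' W'U fWW' fW').
Qed.

End Local.

(** * Difference calculus of rational polynomials *)

Section Polynomials.
Implicit Types (p q : {poly rat}).

Definition Delta p := p \Po ('X + 1) - p.

Lemma horner_Delta p x : (Delta p).[x] = p.[x + 1] - p.[x].
Proof. by rewrite /Delta hornerD hornerN horner_comp hornerD hornerX hornerC. Qed.

Lemma DeltaD p q : Delta (p + q) = Delta p + Delta q.
Proof. by rewrite /Delta comp_polyD opprD addrACA. Qed.

Lemma Delta_mulX p c : Delta (p * 'X + c%:P) = Delta p * 'X + Delta p + p.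
Proof.
rewrite /Delta comp_polyD comp_polyM comp_polyX comp_polyC mulrDr mulr1.
by rewrite mulrBl; ring.
Qed.

(** Delta lowers the degree by one, like the derivative, and multiplies the
    leading coefficient by the same number. *)
Lemma Delta_coef n p : (size p <= n.+1)%N ->
  (size (Delta p) <= n)%N /\ (Delta p)`_n.-1 = n%:R * p`_n.
Proof.
elim: n p => [|n IH] p sp.
  have -> : p = (p`_0)%:P by apply: size1_polyC.
  by rewrite /Delta comp_polyC subrr size_poly0 coef0 mul0r.
have pE : p = drop_poly 1 p * 'X + (p`_0)%:P.
  rewrite -{1}[p](poly_take_drop 1) expr1 addrC; congr (_ + _).
  by apply/polyP => -[|i]; rewrite coef_take_poly coefC.
set q := drop_poly 1 p in pE; have [|sD cD] := IH q.
  by rewrite size_drop_poly leq_subLR add1n.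
have qn : q`_n = p`_n.+1 by rewrite coef_drop_poly addn1.
have sq : (size q <= n.+1)%N by rewrite size_drop_poly leq_subLR add1n.
rewrite pE Delta_mulX -pE; split.
  rewrite !(leq_trans (size_polyD _ _)) // geq_max sq andbT.
  rewrite (leq_trans (size_polyD _ _)) // geq_max (leqW sD) andbT.
  by rewrite (leq_trans (size_polyMleq _ _)) // size_polyX addn2.
rewrite coefD coefD coefMX /= [(Delta q)`_n]nth_default // addr0 qn -natr1 mulrDl mul1r.
by case: (n) cD qn => [|k] -> ->; rewrite ?mul0r.
Qed.

Lemma size_Delta p : size (Delta p) = (size p).-1.
Proof.
case sp: (size p) => [|n] /=.
  have -> : p = 0 by apply/eqP; rewrite -size_poly_eq0 sp.
  by rewrite /Delta comp_poly0 subrr size_poly0.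
have [|sD cD] := @Delta_coef n p; first by rewrite sp.
apply/eqP; rewrite eqn_leq sD /=; case: n sp sD cD => // n sp sD cD.
rewrite ltnNge; apply/negP => sn; move: cD; rewrite [LHS]nth_default // => /esym/eqP.
rewrite mulf_eq0 pnatr_eq0 /= => /eqP p0.
have : lead_coef p != 0 by rewrite lead_coef_eq0 -size_poly_eq0 sp.
by rewrite lead_coefE sp p0 eqxx.
Qed.

(** Cancel the leading term c X^n with c X^(n+1) / (n+1) and go on. *)
Lemma antidifference p : exists q, Delta q = p.
Proof.
have [n sp] := ubnPleq (size p); elim: n p sp => [|n IH] p sp.
  exists 0; rewrite /Delta comp_poly0 subrr; apply/esym/eqP.
  by rewrite -size_poly_eq0 -leqn0.
pose q0 := (p`_n / n.+1%:R) *: 'X^(n.+1).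
have [|sD cD] := @Delta_coef n.+1 q0.
  by rewrite (leq_trans (size_scale_leq _ _)) // size_polyXn.
have [|q qE] := IH (p - Delta q0).
  apply/leq_sizeP => j; rewrite leq_eqVlt => /orP[/eqP <-|nj].
    rewrite coefB [(Delta q0)`_n]cD coefZ coefXn eqxx mulr1 mulrC divfK ?subrr //.
    by rewrite pnatr_eq0.
  by rewrite coefB !nth_default ?subrr // ?(leq_trans _ nj).
by exists (q + q0); rewrite DeltaD qE subrK.
Qed.

Lemma size_shift p c : (size (p \Po ('X + c%:R%:P) - p)%R <= (size p).-1)%N.
Proof.
elim: c => [|c IH]; first by rewrite polyC0 addr0 comp_polyXr subrr size_poly0.
set r := _ - p in IH.
have -> : p \Po ('X + c.+1%:R%:P) - p = r \Po ('X + 1) + Delta p.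
  rewrite /r /Delta comp_polyD raddfN /= -comp_polyA comp_polyD comp_polyX comp_polyC.
  by rewrite -natr1 polyCD [c%:R%:P + _]addrC !addrA subrK.
rewrite (leq_trans (size_polyD _ _)) // geq_max size_Delta leqnn andbT.
by rewrite size_comp_poly2 // size_XaddC.
Qed.


(** A bound e away from 0 is what makes the induction on the degree work: a
    sequence whose steps are at least e tends to infinity. *)
Lemma poly_eventually_pos p : 0 < lead_coef p ->
  exists e N, 0 < e /\ forall n : nat, (N <= n)%N -> e <= p.[n%:R].
Proof.
have [n sp] := ubnPleq (size p); elim: n p sp => [|n IH] p sp.
  move: sp; rewrite leqn0 size_poly_eq0 => /eqP ->.
  by rewrite lead_coef0 ltxx.
move=> lp; have p0 : p != 0 by apply: contraTneq lp => ->; rewrite lead_coef0 ltxx.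
case sE: (size p) => [|[|k]].
- by move/eqP: sE; rewrite size_poly_eq0 (negPf p0).
- exists (lead_coef p), 0%N; split=> // i _; have /size_poly1P[c _ ->] : size p == 1%N by rewrite sE.
  by rewrite lead_coefC hornerC.
have [|sD cD] := @Delta_coef k.+1 p; first by rewrite sE.
have sDE : size (Delta p) = k.+1 by rewrite size_Delta sE.
have [||e [N [e0 NP]]] := IH (Delta p).
- by rewrite sDE -ltnS -sE.
- by rewrite lead_coefE sDE cD; move: lp; rewrite lead_coefE sE; apply: mulr_gt0.
have [M MP] : exists M : nat, (e - p.[N%:R]) / e <= M%:R.
  set x := _ / e; exists (Num.bound `|x|); apply/ltW/(le_lt_trans (ler_norm _)).
  exact/archi_boundP/normr_ge0.
have pN i : p.[N%:R] + i%:R * e <= p.[(N + i)%:R].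
  elim: i => [|i IHi]; first by rewrite mul0r addr0 addn0.
  have := NP (N + i)%N (leq_addr _ _); rewrite horner_Delta natr1 -addnS => De.
  rewrite -natr1 mulrDl mul1r addrA.
  by apply: (le_trans (lerD IHi De)); rewrite addrC subrK.
exists e, (N + M)%N; split=> // i NMi.
have /subnKC <- : (N <= i)%N by apply: leq_trans NMi; exact: leq_addr.
apply: le_trans (pN _); rewrite -lerBlDl -ler_pdivrMr //.
by apply: le_trans MP _; rewrite ler_nat leq_subRL // (leq_trans _ NMi) ?leq_addr.
Qed.

Lemma poly_eventually_leq p q N :
  (forall n : nat, (N <= n)%N -> 0 <= p.[n%:R] <= q.[n%:R]) -> (size p <= size q)%N.
Proof.
move=> pq; rewrite leqNgt; apply/negP => spq.
have p0 : p != 0 by apply: contraTneq spq => ->; rewrite size_poly0.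
have : 0 < lead_coef p.
  rewrite lt_def lead_coef_eq0 p0 leNgt /=; apply/negP => lp.
  have [|e [M [e0 MP]]] := @poly_eventually_pos (- p); first by rewrite lead_coefN oppr_gt0.
  have := MP _ (leq_maxl M N); have /andP[] := pq _ (leq_maxr M N).
  by rewrite !hornerE => pos le1 /(lt_le_trans e0); lra.
rewrite -(@lead_coefDl _ _ (- q)) ?size_polyN // => lpq.
have [e [M [e0 MP]]] := poly_eventually_pos lpq.
have := MP _ (leq_maxl M N); have /andP[_] := pq _ (leq_maxr M N).
by rewrite !hornerE => le1 /(lt_le_trans e0); lra.
Qed.

End Polynomials.

Section EventuallyPolynomial.

Definition epoly (f : nat -> rat) :=
  exists p : {poly rat}, exists N, forall n, (N <= n)%N -> f n = p.[n%:R].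

Lemma epoly_eq (f g : nat -> rat) N :
  (forall n, (N <= n)%N -> f n = g n) -> epoly f -> epoly g.
Proof.
move=> fg [p [M pM]]; exists p, (maxn M N) => n.
by rewrite geq_max => /andP[Mn Nn]; rewrite -fg ?pM.
Qed.

Lemma epolyD (f g : nat -> rat) : epoly f -> epoly g -> epoly (fun n => f n + g n).
Proof.
move=> [p [M pM]] [q [N qN]]; exists (p + q), (maxn M N) => n.
by rewrite geq_max hornerD => /andP[/pM -> /qN ->].
Qed.

Lemma epolyN (f : nat -> rat) : epoly f -> epoly (fun n => - f n).
Proof. by move=> [p [M pM]]; exists (- p), M => n /pM ->; rewrite hornerN. Qed.

Lemma epolyC (c : rat) : epoly (fun=> c).
Proof. by exists c%:P, 0%N => n _; rewrite hornerC. Qed.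

Lemma epoly_shift c (f : nat -> rat) : epoly f -> epoly (fun n => f (n + c)%N).
Proof.
move=> [p [M pM]]; exists (p \Po ('X + c%:R%:P)), M => n Mn.
by rewrite pM ?(leq_trans Mn) ?leq_addr // horner_comp hornerD hornerX hornerC natrD.
Qed.

Lemma epoly_shiftI c (f : nat -> rat) : epoly (fun n => f (n + c)%N) -> epoly f.
Proof.
move=> [p [M pM]]; exists (p \Po ('X - c%:R%:P)), (M + c)%N => n Mn.
have cn : (c <= n)%N by apply: leq_trans Mn; exact: leq_addl.
rewrite -{1}(subnK cn) pM; last by rewrite leq_subRL // addnC.
by rewrite horner_comp hornerD hornerN hornerX hornerC natrB.
Qed.

Lemma epoly_diff (f : nat -> rat) : epoly (fun n => f n.+1 - f n) -> epoly f.
Proof.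
move=> [p [M pM]]; have [q qE] := antidifference p.
exists (q + (f M - q.[M%:R])%:P), M => n /subnKC <-.
elim: (n - M)%N => [|i IH]; first by rewrite addn0 hornerD hornerC subrKC.
have := pM _ (leq_addr i M); rewrite -qE horner_Delta natr1 -addnS => /eqP.
rewrite subr_eq => /eqP ->; rewrite IH !hornerD !hornerC; ring.
Qed.

End EventuallyPolynomial.

(** * The Rees module: Artin-Rees and Hilbert polynomials *)

Section Rees.
Variables (A : comNzRingType) (E : lmodType A).
Implicit Types (U V : set E) (P Q R W : nat -> set E) (G : set (nat * E)) (xs : seq A).

(** Graded submodules of a direct sum of copies of E are encoded as sets of
    pairs (degree, element), so that [acc] applies to them; [slice] and [total]
    pass to families of submodules and back. *)
Definition slice G n : set E := [set v | G (n, v)].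

Definition total W : set (nat * E) := [set p | W p.1 p.2].

Definition stable xs W := forall n x v, x \in xs -> W n v -> W n.+1 (x *: v).

Definition graded xs Q P : set (set (nat * E)) :=
  [set G | [/\ forall n, subm (slice G n), stable xs (slice G),
            forall n, Q n `<=` slice G n & forall n, slice G n `<=` P n]].

(** Degree n part of the polynomials in x of degree less than j with
    coefficients in the graded module R, where x has degree 1. *)
Definition lower x R := fix lower j n : set E :=
  if j is i.+1 then
    addm (lower i n)
      (if (i <= n)%N then homothety (x ^+ i) @` R (n - i)%N else [set 0])
  else [set 0].

(** Degree n part of the Rees module of U: forms of degree n in the elements of
    xs with coefficients in U. *)
Fixpoint rees xs U n : set E :=
  if xs is x :: ys then [set w | exists j, lower x (rees ys U) j n w]
  else if n is 0%N then U else [set 0].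

Section Lower.
Variables (x : A) (R : nat -> set E).
Hypothesis sR : forall n, subm (R n).

Lemma subm_lower j n : subm (lower x R j n).
Proof.
elim: j => [|j IH] //=; apply: subm_add => //.
by case: ifP => // _; exact: subm_im.
Qed.

Lemma lower_S j n : lower x R j n `<=` lower x R j.+1 n.
Proof. by apply: addml; case: ifP => // _; exact: subm_im. Qed.

Lemma lower_le i j n : (i <= j)%N -> lower x R i n `<=` lower x R j n.
Proof. exact: (chain_mono (fun j => @lower_S j n)). Qed.

Lemma lower_inv j n w : lower x R j.+1 n w -> lower x R j n w \/
  (j <= n)%N /\ exists2 v, R (n - j)%N v & lower x R j n (w - x ^+ j *: v).
Proof.
move=> [u lu] /=; case: ifP => [jn [v Rv vE]|_ /eqP]; last by rewrite subr_eq0 => /eqP ->; left.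
by right; split=> //; exists v => //; rewrite -[_ *: v]/(homothety _ v) vE subKr.
Qed.

Lemma lower_intro j n u v : lower x R j (n + j) u -> R n v ->
  lower x R j.+1 (n + j) (u + x ^+ j *: v).
Proof.
move=> lu Rv /=; rewrite leq_addl addnK; exists u => //.
by exists v => //; rewrite addrC addKr.
Qed.

Lemma lower_shift j n w : lower x R j n w -> lower x R j.+1 n.+1 (x *: w).
Proof.
elim: j n w => [|j IH] n w.
  move=> ->; rewrite scaler0; apply: (subm0 (subm_lower 1 n.+1)).
move=> /lower_inv[/IH|[jn [v Rv lw]]]; first exact: lower_le.
have -> : n.+1 = ((n - j) + j.+1)%N by rewrite addnS subnK.
rewrite -(subrK (x ^+ j *: v) w) scalerDr scalerA -exprS.
by apply: lower_intro => //; rewrite addnS subnK //; exact: IH.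
Qed.

Lemma lower_stable j xs : stable xs R -> stable xs (lower x R j).
Proof.
move=> stR n y w yxs; elim: j w => [|j IH] w; first by move=> ->; rewrite /= scaler0.
move=> /lower_inv[/IH|[jn [v Rv lw]]]; first exact: lower_le.
rewrite -(subrK (x ^+ j *: v) w) scalerDr scalerA mulrC -scalerA.
have -> : n.+1 = ((n - j).+1 + j)%N by rewrite addSn subnK.
by apply: lower_intro; [rewrite addSn subnK //; exact: IH|exact: stR].
Qed.

End Lower.

Lemma subm_rees xs U n : subm U -> subm (rees xs U n).
Proof.
move=> sU; elim: xs n => [|x xs IH] n /=; first by case: n.
split=> [|a v w [i vi] [j wj]]; first by exists 0%N.
have sl := @subm_lower x (rees xs U) IH.
exists (maxn i j); apply: (submD (sl _ _)); first apply: (submZ _ (sl _ _)).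
  by apply: lower_le vi => //; exact: leq_maxl.
by apply: lower_le wj => //; exact: leq_maxr.
Qed.

Lemma rees_stable xs U : subm U -> stable xs (rees xs U).
Proof.
move=> sU; elim: xs => [//|x xs IH] n y w yxs [j wj].
have sR k : subm (rees xs U k) by exact: subm_rees.
move: yxs; rewrite inE => /orP[/eqP ->|yxs]; first by exists j.+1; exact: lower_shift.
by exists j; apply: (lower_stable sR IH).
Qed.

Lemma rees0 xs U : subm U -> U `<=` rees xs U 0%N.
Proof.
move=> sU; elim: xs => [|x xs IH] //= u /IH Uu; exists 1%N.
have sR k : subm (rees xs U k) by exact: subm_rees.
have := @lower_intro x (rees xs U) 0 0 0 u; rewrite add0r expr0 scale1r; apply => //.
Qed.

Lemma powI_rees xs (J : set A^o) U n : subm U ->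
  (forall a, J a -> gspan [set` (xs : seq A^o)] a) -> powI J n U `<=` rees xs U n.
Proof.
move=> sU Jxs; elim: n => [|n IH]; first exact: rees0.
apply: mulI_sub => [|a w /Jxs Ja /IH Rw]; first exact: subm_rees.
have: (scale_by w @^-1` rees xs U n.+1) a; last by [].
have sR := @subm_rees xs U n.+1 sU.
apply: gspan_sub Ja; first exact: subm_preim.
by move=> y /= yxs; exact: rees_stable.
Qed.

(** Hilbert's basis theorem for the Rees module, one variable x at a time.  For
    a graded submodule G, the coefficients v of top terms x^j v of elements of
    G form a graded submodule over the remaining variables, increasing in j;
    G is determined by these submodules. *)
Lemma rees_acc xs U : noeth E -> subm U ->
  acc (graded xs (fun=> [set 0]) (rees xs U)).
Proof.
move=> noethE sU; elim: xs => [|x xs IH] F CF FS.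
  have [N NP] := noethE (fun k => slice (F k) 0%N)
    (fun k => let: And4 s _ _ _ := CF k in s 0%N) (fun k v => FS k (0%N, v)).
  exists N => n Nn [[|i] v] Fv; first exact: (NP n Nn v).
  have [_ _ _ /(_ _ _ Fv) /= ->] := CF n; have [s _ _ _] := CF N; exact: (subm0 (s i.+1)).
have sF k n : subm (slice (F k) n) by case: (CF k).
pose R := rees xs U; have sR n : subm (R n) by exact: subm_rees.
have slow := subm_lower x sR.
pose L j k : set (nat * E) := [set p | R p.1 p.2 /\
  exists2 u, lower x R j (p.1 + j) u & F k ((p.1 + j)%N, u + x ^+ j *: p.2)].
have [K KP] : exists K, forall j k, (K <= k)%N -> L j k `<=` L j K.
  apply: (acc2 IH) => j k.
  - split=> [n|n y v yxs [Rv [u lu Fu]]|n v ->|n v []//].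
    + split=> [|a v w [Rv [u lu Fu]] [Rw [t lt Ft]]].
        split; first exact: (subm0 (sR n)).
        by exists 0; rewrite ?scaler0 ?addr0; [exact: (subm0 (slow _ _))|exact: (subm0 (sF _ _))].
      split; first exact: (submD (sR n) (submZ a (sR n) Rv) Rw).
      exists (a *: u + t); first exact: (submD (slow _ _) (submZ a (slow _ _) lu) lt).
      rewrite /= scalerDr scalerA mulrC -scalerA addrACA -scalerDr.
      exact: (submD (sF _ _) (submZ a (sF _ _) Fu) Ft).
    + split; first exact: rees_stable.
      exists (y *: u); first exact: (lower_stable sR (rees_stable sU)).
      rewrite /= addSn scalerA mulrC -scalerA -scalerDr.
      by have [_ st _ _] := CF k; apply: st => //; rewrite inE yxs orbT.
    + split; first exact: (subm0 (sR n)).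
      by exists 0; rewrite ?scaler0 ?addr0; [exact: (subm0 (slow _ _))|exact: (subm0 (sF _ _))].
  - move=> [n v] [Rv [u lu Fu]]; split=> //; exists (x *: u); rewrite /= addnS.
      exact: lower_shift.
    rewrite exprS -scalerA -scalerDr.
    by have [_ st _ _] := CF k; apply: st => //; rewrite inE eqxx.
  - by move=> [n v] [Rv [u lu Fu]]; split=> //; exists u => //; exact: FS.
exists K => k Kk [n w] Fw; have [_ _ _ /(_ _ _ Fw)[j lj]] := CF k.
have FKk : F K `<=` F k by exact: chain_mono.
elim: j w Fw lj => [|j IHj] w Fw; first by move=> ->; exact: (subm0 (sF K n)).
move=> /(lower_inv) [|[jn [v Rv lw]]]; first exact: IHj.
have [] := KP j k Kk ((n - j)%N, v).
  by split=> //; exists (w - x ^+ j *: v); rewrite /= subnK // subrK.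
rewrite /= subnK // => _ [u lu FKu].
rewrite -(subrK (u + x ^+ j *: v) w).
apply: (submD (sF K n)) => //; apply: IHj.
  by apply: (submB (sF k n)) => //; exact: FKk.
rewrite opprD addrA addrAC.
exact: (submB (slow _ _)).
Qed.

End Rees.

Section ArtinRees.
Variables (A : comNzRingType) (E : lmodType A) (J : set A^o) (xs : seq A).
Hypotheses (noethE : noeth E) (Jxs : forall a, J a <-> gspan [set` (xs : seq A^o)] a).
Implicit Types (U V B F : set E).

Lemma mem_gens x : x \in xs -> J x.
Proof. by move=> xxs; apply/Jxs; exact: (@sub_gspan _ _ [set` (xs : seq A^o)]). Qed.

(** The submodules equal to W up to degree k, and generated by W k from there
    on, increase with k. *)
Lemma artin_rees_seq (W : nat -> set E) : (forall n, subm (W n)) ->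
  (forall n, W n `<=` powI J n setT) -> (forall n, mulI J (W n) `<=` W n.+1) ->
  exists c, forall n, W (n + c)%N = powI J n (W c).
Proof.
move=> sW WJ WS.
have Wpow c n : powI J n (W c) `<=` W (n + c)%N.
  elim: n => [//|n IH]; apply: subset_trans (WS _); exact: mulIS.
pose V k n := if (n <= k)%N then W n else powI J (n - k) (W k).
have VW k n : V k n `<=` W n.
  rewrite /V; case: leqP => [_|kn]; first exact: subset_refl.
  by have := @Wpow k (n - k)%N; rewrite subnK // ltnW.
have VE k n : (k <= n)%N -> V k n = powI J (n - k) (W k).
  move=> kn; rewrite /V; case: ifP => // nk.
  by have -> : n = k by [apply/eqP; rewrite eqn_leq nk]; rewrite subnn.
have sV k n : subm (V k n) by rewrite /V; case: ifP => // _; exact: subm_powI.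
have [c cP] : exists N, forall k, (N <= k)%N -> total (V k) `<=` total (V N).
  apply: (rees_acc (xs := xs) noethE (@subm_setT _ E)) => k.
    split=> [n|n x v xxs Vv|n v ->|n v /VW/WJ].
    - exact: sV.
    - rewrite /slice /total /= in Vv *; have Jx := mem_gens xxs.
      have [kn|nk] := leqP k n.
        rewrite VE ?(leqW kn) // subSn //; apply: mem_mulI => //.
        by move: Vv; rewrite VE.
      by rewrite /V nk; apply: WS; apply: mem_mulI => //; exact: (VW k).
    - exact: (subm0 (sV k n)).
    - by apply: powI_rees => // a /Jxs.
  move=> [n v]; rewrite /total /=; have [nk|kn] := leqP n k.
    by rewrite /V nk (leqW nk).
  move/subnK: kn => <-; set i := (n - k.+1)%N.
  rewrite !VE ?leq_addl ?(leq_trans (leqnSn k)) ?leq_addl // addnK addnS -addSn addnK.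
  by rewrite /powI iterSr => /(powIS (n := i)); apply; exact: WS.
exists c => n; apply/seteqP; split; last exact: Wpow.
move=> v Wv; have := cP (n + c)%N (leq_addl _ _) ((n + c)%N, v).
by rewrite /total /= [V c _]VE ?leq_addl // addnK; apply; rewrite VE // subnn.
Qed.

Lemma artin_rees F : subm F -> exists c, forall n,
  F `&` powI J (n + c) setT = powI J n (F `&` powI J c setT).
Proof.
move=> sF; apply: (@artin_rees_seq (fun n => F `&` powI J n setT)).
- by move=> n; apply: submI => //; exact: subm_powI.
- by move=> n x [].
- move=> n; apply: mulI_sub => [|a x Ja [Fx Ix]].
    by apply: submI => //; exact: (@subm_powI _ _ _ n.+1).
  by split; [exact: submZ|exact: mem_mulI].
Qed.

End ArtinRees.

Section Hilbert.
Variables (A : comNzRingType) (E : lmodType A).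
Implicit Types (P Q : nat -> set E) (xs : seq A).

(** Multiplication by one of the variables gives exact sequences
    0 -> K n -> P n / Q n -> P (n+1) / Q (n+1) -> C (n+1) -> 0 whose outer terms
    are graded modules over the other variables.  Since all of these are
    subquotients of the one module E, the chain condition passes to them. *)
Lemma hilbert_polynomial xs Q P :
  (forall n, subm (Q n)) -> (forall n, subm (P n)) -> (forall n, Q n `<=` P n) ->
  stable xs Q -> stable xs P -> (forall n, fin (Q n) (P n)) ->
  acc (graded xs Q P) -> epoly (fun n => (len (Q n) (P n))%:R).
Proof.
elim: xs Q P => [|x xs IH] Q P sQ sP QP stQ stP finQP accQP.
  pose V k n := if (n <= k)%N then P n else Q n.
  have [N NP] : exists N, forall k, (N <= k)%N -> total (V k) `<=` total (V N).
    have sV k n : subm (V k n) by rewrite /V; case: ifP.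
    apply: accQP => k.
      split=> [n|//|n v Qv|n v]; first exact: sV.
        by rewrite /slice /total /V /=; case: ifP => // _; exact: QP.
      by rewrite /slice /total /V /=; case: ifP => // _; exact: QP.
    move=> [n v]; rewrite /total /V /=; case: (leqP n k) => [nk|kn]; first by rewrite leqW.
    by case: ifP => // _ /QP.
  apply: (epoly_eq (N := N.+1) _ (epolyC 0)) => n Nn.
  suff -> : P n = Q n by rewrite (len_refl (sQ n)).2.
  apply/seteqP; split=> // v Pv; have := NP n (ltnW Nn) (n, v).
  by rewrite /total /V /= leqnn leqNgt Nn; apply.
pose K n := P n `&` (homothety x @^-1` Q n.+1).
pose C n := if n is i.+1 then addm (homothety x @` P i) (Q n) else Q n.
have sK n : subm (K n) by apply: submI => //; exact: subm_preim.
have xP n v : P n v -> P n.+1 (x *: v) by apply: stP; rewrite inE eqxx.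
have xQ n v : Q n v -> Q n.+1 (x *: v) by apply: stQ; rewrite inE eqxx.
have sxP n : subm (homothety x @` P n) by exact: subm_im.
have sC n : subm (C n) by case: n => [|n] //=; exact: subm_add.
have KP n : K n `<=` P n by move=> v [].
have QK n : Q n `<=` K n by move=> v Qv; split; [exact: QP|exact: xQ].
have QC n : Q n `<=` C n by case: n => [|n] //=; exact: addmr.
have CP n : C n `<=` P n.
  by case: n => [|n] //=; apply: addm_sub => // _ [v Pv <-]; exact: xP.
have ys (W : nat -> set E) : stable (x :: xs) W -> stable xs W.
  by move=> st n y v yxs; apply: st; rewrite inE yxs orbT.
have finQK n : fin (Q n) (K n) by exact: fin_sub (finQP n).
have finKP n : fin (K n) (P n) by exact: fin_sub (finQP n).
have finQC n : fin (Q n) (C n) by exact: fin_sub (finQP n).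
have finCP n : fin (C n) (P n) by exact: fin_sub (finQP n).
have polK : epoly (fun n => (len (Q n) (K n))%:R).
  apply: IH => //; first exact: ys.
    move=> n y v yxs [Pv Qxv]; split; first exact: (ys P stP n y v).
    by rewrite /= /homothety scalerA mulrC -scalerA; exact: (ys Q stQ n.+1 y).
  move=> F CF; apply: accQP => k; have [s st QF FK] := CF k.
  split=> // [n y v|n v /FK[]//]; rewrite inE => /orP[/eqP ->|]; last exact: st.
  by move=> /FK[_ Qxv]; exact: QF.
have polC : epoly (fun n => (len (C n) (P n))%:R).
  apply: IH => //; last first.
  - move=> F CF; apply: accQP => k; have [s st CFk FP] := CF k.
    split=> // [n y v|n]; last exact: subset_trans (QC n) (CFk n).
    rewrite inE => /orP[/eqP ->|]; last exact: st.
    move=> /FP Pv; apply: CFk; apply: addml => //; by exists v.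
  - exact: ys.
  move=> [|n] y v yxs /=.
    by move=> Qv; apply: addmr => //; exact: (ys Q stQ 0%N y v).
  move=> [_ [u Pu <-] Qvu]; exists (x *: (y *: u)); first by exists (y *: u) => //; exact: (ys P stP n y u).
  by rewrite /homothety scalerA mulrC -scalerA -scalerBr; exact: (ys Q stQ n.+1 y).
have lenKC n : len (K n) (P n) = len (Q n.+1) (C n.+1).
  have [_ le1] : fin (K n) (P n) /\ (len (K n) (P n) <= len (Q n.+1) (C n.+1))%N.
    apply: (len_inj (f := homothety x)) => //.
    by move=> u Pu; apply: addml => //; exists u.
  have [_ le2] : fin (Q n.+1) (C n.+1) /\ (len (Q n.+1) (C n.+1) <= len (K n) (P n))%N.
    apply: (len_surj (f := homothety x)) => //; first by move=> v [].
    by move=> v [_ [u Pu <-] Qvu]; exists u.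
  by apply/eqP; rewrite eqn_leq le1 le2.
apply: epoly_diff.
apply: (epoly_eq (N := 0) _ (epolyD (epoly_shift 1 polC) (epolyN polK))) => n _.
have [_ ->] := len_add (sQ n) (sK n) (sP n) (@QK n) (@KP n) (finQK n) (finKP n).
have [_ ->] := len_add (sQ n.+1) (sC n.+1) (sP n.+1) (@QC n.+1) (@CP n.+1) (finQC n.+1) (finCP n.+1).
rewrite addn1 lenKC !natrD; ring.
Qed.

End Hilbert.

(** * Growth of eventually polynomial functions *)

Section Growth.
Implicit Types f g : nat -> nat.

(** Sizes, that is degrees plus one, make the zero function no exception. *)
Definition epoly_size f s := exists p : {poly rat}, size p = s /\
  exists N, forall n, (N <= n)%N -> (f n)%:R = p.[n%:R].

Lemma epoly_sizeP f : epoly (fun n => (f n)%:R) -> exists s, epoly_size f s.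
Proof. by move=> [p [N pN]]; exists (size p), p; split=> //; exists N. Qed.

Lemma epoly_size_leq f g s t N : epoly_size f s -> epoly_size g t ->
  (forall n, (N <= n)%N -> (f n <= g n)%N) -> (s <= t)%N.
Proof.
move=> [p [<- [Np pP]]] [q [<- [Nq qP]]] fg.
apply: (@poly_eventually_leq _ _ (maxn N (maxn Np Nq))) => n.
by rewrite !geq_max => /and3P[Nn pn qn]; rewrite -pP // -qP // ler0n ler_nat fg.
Qed.

Lemma epoly_size_shift c f s : epoly_size f s -> epoly_size (fun n => f (n + c)%N) s.
Proof.
move=> [p [sp [N pN]]]; exists (p \Po ('X + c%:R%:P)); split.
  by rewrite size_comp_poly2 // size_XaddC.
exists N => n Nn; rewrite pN ?(leq_trans Nn) ?leq_addr //.
by rewrite horner_comp hornerD hornerX hornerC natrD.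
Qed.

Lemma epoly_size_diff c f g s : epoly_size f s ->
  (forall n, f (n + c) = f n + g n)%N -> exists2 t, (t <= s.-1)%N & epoly_size g t.
Proof.
move=> [p [<- [N pN]]] fg; exists (size (p \Po ('X + c%:R%:P) - p)%R); first exact: size_shift.
exists (p \Po ('X + c%:R%:P) - p); split=> //; exists N => n Nn.
rewrite hornerD hornerN horner_comp hornerD hornerX hornerC -natrD.
by rewrite -!pN ?(leq_trans Nn) ?leq_addr // fg natrD addrC addKr.
Qed.

Lemma epoly_size_diff1 f g s : epoly_size f s ->
  (forall n, f n.+1 = f n + g n)%N -> epoly_size g s.-1.
Proof.
move=> [p [<- [N pN]]] fg; exists (Delta p); split; first exact: size_Delta.
exists N => n Nn; rewrite horner_Delta natr1 -!pN ?(leqW Nn) // fg natrD.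
by rewrite addrC addKr.
Qed.

Lemma epoly_size_scale k f s : (0 < k)%N -> epoly_size f s ->
  epoly_size (fun n => k * f n)%N s.
Proof.
move=> k0 [p [<- [N pN]]]; exists (k%:R *: p); split.
  by rewrite size_scale // pnatr_eq0 -lt0n.
by exists N => n Nn; rewrite hornerZ natrM pN.
Qed.

Lemma epoly_sizeD f g s t : epoly_size f s -> epoly_size g t ->
  exists2 u, (u <= maxn s t)%N & epoly_size (fun n => f n + g n)%N u.
Proof.
move=> [p [<- [N pN]]] [q [<- [M qM]]]; exists (size (p + q)%R); first exact: size_polyD.
exists (p + q); split=> //; exists (maxn N M) => n.
by rewrite geq_max hornerD natrD => /andP[/pN -> /qM ->].
Qed.

Lemma epoly_sizeC k : exists2 s, (s <= 1)%N & epoly_size (fun=> k) s.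
Proof.
exists (size (k%:R%:P : {poly rat})); first exact: size_polyC_leq1.
by exists k%:R%:P; split=> //; exists 0%N => n _; rewrite hornerC.
Qed.

Lemma epoly_size_bound f s C d : epoly_size f s ->
  (forall n, f n <= C * n.+1 ^ d)%N -> (s <= d.+1)%N.
Proof.
move=> fs fC; pose q : {poly rat} := C%:R *: ('X + 1) ^+ d.
have sq : (size q <= d.+1)%N.
  apply: leq_trans (size_scale_leq _ _) _.
  by rewrite -[X in _ + X]opprK -polyCN (size_exp_XsubC d (-1)).
apply: leq_trans sq; apply: (epoly_size_leq (N := 0) fs (g := fun n => C * n.+1 ^ d)%N) => [|n _]; last exact: fC.
exists q; split=> //; exists 0%N => n _.
by rewrite hornerZ horner_exp hornerD hornerX hornerC natr1 natrM natrX.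
Qed.

Lemma epoly_size_gt0 f s : epoly_size f s -> (forall n, 0 < f n.+1)%N -> (0 < s)%N.
Proof.
move=> [p [<- [N pN]]] f0; rewrite lt0n size_poly_eq0; apply/eqP => p0.
by have := pN N.+1 (leqnSn _); rewrite p0 horner0 => /eqP; rewrite pnatr_eq0 gtn_eqF.
Qed.

End Growth.

(** * Hilbert-Samuel functions and Krull dimension *)

Section HilbertSamuel.
Variables (A : comNzRingType) (m I : idealr A).
Hypotheses (noethA : noeth A^o) (A_local : local_ring m) (I_primary : primary_to m I).
Variable xs : seq A.
Hypothesis Ixs : forall a, mset I a <-> gspan [set` (xs : seq A^o)] a.

Local Notation pow n U := (powI (mset I) n U).

Lemma primary_sub : mset I `<=` mset m.
Proof. by move=> x Ix; apply/(I_primary.2 x); exists 1%N; rewrite expr1. Qed.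

Section HilbertSamuelFunction.
Variable E : lmodType A.
Hypothesis noethE : noeth E.
Implicit Types (U V B : set E).

Lemma fin_pow V U n : subm V -> subm U -> V `<=` U -> pow n U `<=` V -> fin V U.
Proof.
move=> sV sU VU UV; apply: (fin_torsion noethA A_local) => // a /(I_primary.2 a)[k ak].
by exists (k * n)%N => u Uu; rewrite exprM; apply/UV/powI_exp.
Qed.

Lemma fin_add_pow B U n : subm B -> subm U -> B `<=` U ->
  fin (addm B (pow n U)) U.
Proof.
move=> sB sU BU; have sp : subm (pow n U) by exact: subm_powI.
apply: (fin_pow (n := n)) => //; [exact: subm_add| |exact: addmr].
by apply: addm_sub => //; exact: powI_sub.
Qed.

(** The Hilbert-Samuel function of U/B. *)
Definition chi B U n := len (addm B (pow n U)) U.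

(** The associated graded module, with terms (B + I^n U)/(B + I^(n+1) U), is a
    quotient of the Rees module of U, and so inherits its chain condition. *)
Lemma chi_poly B U : subm B -> subm U -> B `<=` U -> exists s, epoly_size (chi B U) s.
Proof.
move=> sB sU BU; apply: epoly_sizeP; apply: epoly_diff.
pose P n := addm B (pow n U).
have sp n : subm (pow n U) by exact: subm_powI.
have sP n : subm (P n) by exact: subm_add.
have PS n : P n.+1 `<=` P n.
  apply: addm_sub => //; first exact: addml.
  by apply: subset_trans (addmr (sB)); exact: powI_leq.
have PU n : P n `<=` U by apply: addm_sub => //; exact: powI_sub.
have BP n : B `<=` P n by exact: addml.
have stP : stable xs P.
  move=> n x v xxs [b Bb Pv]; rewrite -(subrK b v) scalerDr addrC.
  by apply: mem_addm; [exact: submZ|apply: mem_mulI => //; exact: (mem_gens Ixs)].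
have finP n : fin (P n.+1) (P n) by apply: fin_sub (fin_add_pow n.+1 sB sU BU).
suff: epoly (fun n => (len (P n.+1) (P n))%:R).
  apply: (epoly_eq (N := 0)) => n _; rewrite /chi.
  have [|_ ->] := len_add (sP n.+1) (sP n) sU (@PS n) (@PU n) (finP n).
    exact: fin_add_pow.
  by rewrite natrD addrK.
apply: (hilbert_polynomial (xs := xs)) => //; first by move=> n x v; exact: stP.
move=> F CF FS; pose G k := total (fun n => slice (F k) n `&` pow n U).
have [N NP] : exists N, forall k, (N <= k)%N -> G k `<=` G N.
  apply: (rees_acc (xs := xs) noethE sU) => k; last by move=> [n v] [/FS Fv pv].
  have [s st QF FP] := CF k; split=> [n|n x v xxs [Fv pv]|n v ->|n v [_]].
  - exact: (submI (s n) (sp n)).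
  - by split; [exact: st|apply: mem_mulI => //; exact: (mem_gens Ixs)].
  - by split; [exact: (subm0 (s n))|exact: (subm0 (sp n))].
  - by apply: powI_rees => // a /Ixs.
exists N => k Nk [n v] Fv; have [s st QF FP] := CF k; have [sN _ QFN _] := CF N.
have [b Bb pv] := FP _ _ Fv.
have Fb : F k (n, b) by apply: QF; exact: BP.
have [|Fvb _] := NP k Nk (n, v - b).
  by split=> //; exact: (submB (s n) Fv Fb).
by rewrite -(subrK b v); apply: (submD (sN n)) => //; apply: QFN; exact: BP.
Qed.

End HilbertSamuelFunction.

Implicit Types (J P Q : set A^o).

Definition spec J : set (set A^o) :=
  [set P : set A^o | [/\ idealr_closed (mem (P : set A)),
    prime_idealr_closed (mem (P : set A)) & J `<=` P]].

Lemma spec_subm J P : spec J P -> subm P.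
Proof.
move=> [[P0 _ PP] _ _]; split=> [|a x y Px Py]; first exact: (set_mem P0).
exact: (set_mem (PP a x y (mem_set Px) (mem_set Py))).
Qed.

Lemma spec_proper J P : spec J P -> ~ P 1.
Proof. by move=> [[_ /negP P1 _] _ _] /mem_set. Qed.

Lemma spec_prime J P a b : spec J P -> P (a * b) -> P a \/ P b.
Proof.
move=> [_ pP _] /mem_set Pab; have /orP[Pa|Pb] := pP a b Pab.
  by left; exact: (set_mem Pa).
by right; exact: (set_mem Pb).
Qed.

Lemma mem_spec J P : subm P -> ~ P 1 -> (forall a b, P (a * b) -> P a \/ P b) ->
  J `<=` P -> spec J P.
Proof.
move=> sP P1 pP JP; split=> //; first split=> [||a x y Px Py].
  - exact: (mem_set (subm0 sP)).
  - by apply/negP => P1'; apply: P1; exact: (set_mem P1').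
  - exact: (mem_set (submD sP (submZ a sP (set_mem Px)) (set_mem Py))).
by move=> a b Pab; have [Pa|Pb] := pP a b (set_mem Pab);
  apply/orP; [left; exact: (mem_set Pa)|right; exact: (mem_set Pb)].
Qed.

Lemma spec_cons J J' P k : spec J P -> P `<=` J' -> ~ J' `<=` P ->
  chain_lengths (spec J') k -> chain_lengths (spec J) k.+1.
Proof.
move=> JP PJ' J'P [F [FI FS]].
exists (fun i => if i is j.+1 then F j else P); split=> -[|i] ik //.
- have [? ? J'F] := FI i ik; have [_ _ sJP] := JP; split=> //.
  exact: subset_trans sJP (subset_trans PJ' J'F).
- have [_ _ J'F] := FI 0%N isT; split; first exact: subset_trans J'F.
  by apply: contra_not J'P; exact: subset_trans.
- exact: FS.
Qed.

(** Multiplication by x maps A/(J' + I^k) onto (J + x A + I^n)/(J + I^n). *)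
Lemma chi_step J J' x k n : subm J -> subm J' ->
  (forall a, J' a -> J (x * a)) -> (forall a, pow k setT a -> pow n setT (x * a)) ->
  (chi J setT n <= chi J' setT k + chi (addm J (scale_by (x : A^o) @` setT)) setT n)%N.
Proof.
move=> sJ sJ' J'J kn; set K := addm J _.
have sx : subm (scale_by (x : A^o) @` setT) by exact: subm_im.
have sK : subm K by exact: subm_add.
have sp i : subm (pow i [set: A^o]) by exact: subm_powI.
have JK : addm J (pow n setT) `<=` addm K (pow n setT).
  apply: addm_sub; [exact: subm_add| |exact: addmr].
  by apply: subset_trans (addml _); [exact: addml|exact: sp].
have fJ : fin (addm J (pow n setT)) setT by exact: fin_add_pow.
have [||_] := len_add (subm_add sJ (sp n)) (subm_add sK (sp n)) (@subm_setT _ A^o) JK (@subsetT _ _).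
- exact: fin_sub fJ.
- exact: fin_sub fJ.
rewrite /chi => ->; rewrite leq_add2r.
have [] : fin (addm J (pow n setT)) (addm K (pow n setT)) /\
   (len (addm J (pow n setT)) (addm K (pow n setT)) <= len (addm J' (pow k setT)) setT)%N; last by [].
have sJk := subm_add sJ' (sp k); have sJn := subm_add sJ (sp n).
have sKn := subm_add sK (sp n).
apply: (len_surj (f := homothety x)) => //.
- move=> v [j J'j pv]; rewrite /= /homothety -(subrK j v) scalerDr addrC.
  by apply: mem_addm; [exact: J'J|exact: kn].
- move=> u [y [j Jj [a _ ax]] pu].
  exists a => //; rewrite -(subrK y u) -addrA addrC; apply: mem_addm => //.
  have -> : y - homothety x a = j; last by [].
  by rewrite -[homothety x a]/(x * a) mulrC -[a * x]/(scale_by (x : A^o) a) ax subKr.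
- exact: fin_add_pow.
Qed.

(** For a maximal counterexample J, a zero divisor modulo J would split A/J into
    two smaller quotients; so J is prime.  Adding to J an element of I outside it
    shortens the chains of primes, and by [chi_step] the differences of the
    function grow at most like that of the enlarged ideal. *)
Lemma chi_upper d J : subm J -> ~ chain_lengths (spec J) d.+1 ->
  exists C, forall n, (chi J setT n <= C * n.+1 ^ d)%N.
Proof.
elim/ltn_ind: d J => d IHd J sJ.
move: J sJ; apply: (acc_ind noethA) => J sJ IHJ nch.
have nch' K : J `<=` K -> ~ chain_lengths (spec K) d.+1.
  move=> JK; apply: contra_not nch; apply: chain_sub => P [? ? KP].
  by split=> //; exact: subset_trans KP.
have sx (x : A) : subm (scale_by (x : A^o) @` setT) by exact: subm_im.
have [J1|J1] := pselect (J 1).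
  exists 0%N => n; rewrite mul0n leqn0; apply/eqP.
  have JT : J = setT by apply/seteqP; split=> // a _; rewrite -[a]mulr1; exact: (submZ a sJ).
  have -> : chi J setT n = len setT [set: A^o]; last by case: (len_refl (@subm_setT _ A^o)).
  congr (len _ _); apply/seteqP; split=> // a _; rewrite JT; apply: addml => //.
  exact: subm_powI.
have [pJ|npJ] := pselect (forall a b, J (a * b) -> J a \/ J b); last first.
  have [a [b [Jab Ja Jb]]] : exists a b, [/\ J (a * b), ~ J a & ~ J b].
    apply: contrapT => nab; apply: npJ => a b Jab; apply: contrapT => nJ.
    by apply: nab; exists a, b; split=> // ?; apply: nJ; [left|right].
  pose K1 := addm J (scale_by (a : A^o) @` setT); pose K2 := homothety a @^-1` J.
  have JK1 : J `<=` K1 by exact: addml.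
  have JK2 : J `<=` K2 by move=> c Jc; exact: (submZ a sJ).
  have sK1 : subm K1 by exact: subm_add.
  have sK2 : subm K2 by exact: subm_preim.
  have [||C1 C1P] := IHJ K1 sK1 JK1; last 1 first.
  have [||C2 C2P] := IHJ K2 sK2 JK2; last 1 first.
  - exists (C2 + C1)%N => n; rewrite mulnDl.
    apply: leq_trans (leq_add (C2P n) (C1P n)); apply: chi_step => // c pc.
    have sp := @subm_powI _ _ (mset I) n _ (@subm_setT _ A^o).
    exact: (submZ a sp pc).
  - by move/(_ b Jab).
  - exact: nch'.
  - move=> nK1; apply/Ja/nK1; apply: addmr => //; exists 1 => //.
    by rewrite /scale_by scale1r.
  - exact: nch'.
have JJ : spec J J by exact: mem_spec.
have [IJ|nIJ] := pselect (mset I `<=` J).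
  exists (len J setT) => n; apply: (@leq_trans (len J setT)); last first.
    by rewrite leq_pmulr // expn_gt0.
  have fJ : fin J setT.
    apply: (@fin_pow A^o noethA J setT 1) => //.
    by apply: mulI_sub => // a y /IJ Ja _; rewrite [_ *: _]mulrC; exact: (submZ y sJ).
  by apply: len_sub => //; [apply: subm_add => //; exact: subm_powI|apply: addml; exact: subm_powI].
have [x Ix Jx] : exists2 x, mset I x & ~ J x.
  by apply: contrapT => nx; apply: nIJ => x Ix; apply: contrapT => Jx; apply: nx; exists x.
case: d IHd nch nch' IHJ => [|d] IHd nch _ _.
  exfalso; apply: nch; apply: (spec_cons (J' := mset m) JJ).
  - exact: (proper_sub_m noethA A_local).
  - by move=> mJ; apply/Jx/mJ/primary_sub.
  - exists (fun=> mset m); split=> // i _; apply: mem_spec => //; first exact: subm_mset.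
      exact: mset1.
    by move=> a b; exact: (m_prime noethA A_local).
pose K := addm J (scale_by (x : A^o) @` setT).
have sK : subm K by exact: subm_add.
have JK : J `<=` K by exact: addml.
have [|C CP] := IHd d (ltnSn d) K sK.
  apply: contra_not nch; apply: (spec_cons JJ JK) => KJ; apply: Jx; apply: KJ.
  by apply: addmr => //; exists 1 => //; rewrite /scale_by scale1r.
exists C; elim=> [|n IHn].
  have -> : chi J setT 0 = len setT [set: A^o]; last by have [_ ->] := len_refl (@subm_setT _ A^o).
  congr (len _ _); apply/seteqP; split=> // a _; exact: addmr.
apply: (@leq_trans (C * n.+1 ^ d.+1 + C * n.+2 ^ d)%N); last first.
  rewrite -mulnDr leq_mul2l !expnS; apply/orP; right.
  rewrite [leqRHS]mulSn addnC leq_add2l leq_mul2l /=.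
  by case: (posnP d) => [->|d0]; rewrite ?expn0 ?leq_exp2r.
apply: leq_trans (leq_add IHn (CP n.+1)); apply: chi_step => //.
  by move=> a Ja; exact: (submZ x sJ).
by move=> a pa; exact: mem_mulI.
Qed.

(** Each generator adds a quotient of A/(K + I^n). *)
Lemma chi_gens (E : lmodType A) (K : set A^o) (s : seq E) n : noeth E -> subm K ->
  (forall a (x : E), K a -> (a : A) *: x = 0) -> (forall x, gspan [set` s] x) ->
  (len (pow n [set: E]) setT <= size s * chi K setT n)%N.
Proof.
move=> noethE sK K0 sT; set V := pow n setT.
have sV : subm V by exact: subm_powI.
have fV : fin V setT by exact: (@fin_pow E noethE V setT n).
have -> : [set: E] = addm V (gspan [set` s]).
  by apply/seteqP; split=> // x _; apply: addmr.
elim: (s : seq E) => [|e t IH].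
  have -> : addm V (gspan [set` [::]]) = V.
    apply/seteqP; split; last exact: addml.
    by apply: addm_sub => //; apply: gspan_sub.
  by have [_ ->] := len_refl sV.
set V1 := addm V (gspan [set` t]) in IH; set V2 := addm V _.
have sV1 : subm V1 by exact: subm_add.
have sV2 : subm V2 by exact: subm_add.
have V12 : V1 `<=` V2.
  apply: addm_sub => //; first exact: addml.
  apply: gspan_sub => // x xt; apply: addmr => //; apply: sub_gspan.
  by rewrite /= inE xt orbT.
have VV1 : V `<=` V1 by exact: addml.
have [||_ ->] := len_add sV sV1 sV2 VV1 V12.
- exact: fin_sub fV.
- exact: fin_sub fV.
rewrite mulSn addnC; apply: leq_add => //.
have sp : subm (pow n [set: A^o]) by exact: subm_powI.
suff [] : fin V1 V2 /\ (len V1 V2 <= len (addm K (pow n setT)) setT)%N by [].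
apply: (len_surj (f := scale_by e)) => //; first exact: subm_add.
- move=> a [k Kk pa]; rewrite /= /scale_by -(subrK k a) scalerDl (K0 k) // addr0.
  by apply: VV1; apply: (powI_map (f := scale_by e)) pa.
- move=> x [v Vv /gspan_cons[a ta]]; exists a => //.
  rewrite /= /scale_by -(subrK v x) addrAC addrC; apply: mem_addm => //.
  exact: fin_add_pow.
Qed.

Lemma chi_not0 P n : subm P -> ~ P 1 -> (0 < chi P setT n.+1)%N.
Proof.
move=> sP P1; rewrite lt0n; apply/eqP => c0.
have sp : subm (pow n.+1 [set: A^o]) by exact: subm_powI.
have /(_ 1 Logic.I) : setT `<=` addm P (pow n.+1 [set: A^o]).
  by apply: len_eq0 => //; [exact: subm_add|exact: fin_add_pow].
suff : addm P (pow n.+1 [set: A^o]) `<=` mset m by move=> /[apply]; exact: mset1.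
have sm := subm_mset m.
apply: addm_sub => //; first exact: (proper_sub_m noethA A_local).
apply: subset_trans primary_sub => a /=.
apply: mulI_sub; first exact: subm_mset.
by move=> b c Ib _; rewrite [_ *: _]mulrC; exact: (submZ c (subm_mset I)).
Qed.

(** By Artin-Rees, x a in P + I^(n+c) forces a in P + I^n when x lies outside
    the prime P; so A/(P + x A) grows no faster than the differences of the
    Hilbert-Samuel function of A/P. *)
Lemma prime_drop J P Q s t : spec J P -> subm Q -> P `<=` Q -> ~ Q `<=` P ->
  epoly_size (chi P setT) s -> epoly_size (chi Q setT) t -> (t <= s.-1)%N.
Proof.
move=> JP sQ PQ QP Ps Qt; have sP := spec_subm JP.
have [x Qx Px] : exists2 x, Q x & ~ P x.
  by apply: contrapT => nx; apply: QP => x Qx; apply: contrapT => Px; apply: nx; exists x.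
have sx : subm (scale_by (x : A^o) @` setT) by exact: subm_im.
pose F := addm P (scale_by (x : A^o) @` setT).
have sF : subm F by exact: subm_add.
have sp n : subm (pow n [set: A^o]) by exact: subm_powI.
have sPp n := subm_add sP (sp n); have sFp n := subm_add sF (sp n).
have sQp n := subm_add sQ (sp n).
have [c cP] := artin_rees noethA Ixs sF.
have powF n : pow n F `<=` addm P (scale_by (x : A^o) @` pow n setT).
  elim: n => [//|n IH]; apply: mulI_sub; first by apply: subm_add => //; exact: subm_im.
  move=> b w Ib /IH[p Pp [e pe eE]]; exists (b *: p); first exact: submZ.
  exists (b *: e); first exact: mem_mulI.
  by rewrite -scalerBr -eE /scale_by scalerA.
have colon n a : addm P (pow (n + c) setT) (x * a) -> addm P (pow n setT) a.
  move=> [p Pp pxa].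
  have Fxa : (F `&` pow (n + c) setT) (x * a - p).
    split=> //; apply: submB => //; last exact: addml.
    by apply: addmr => //; exists a => //; rewrite /scale_by [RHS]mulrC.
  rewrite cP in Fxa.
  have [q Pq [b pb bE]] : addm P (scale_by (x : A^o) @` pow n setT) (x * a - p).
    by apply/powF/(powIS _ Fxa) => v [].
  rewrite -(subrK b a); apply: mem_addm => //.
  have [] // := @spec_prime _ _ x (a - b) JP.
  have -> : x * (a - b) = p + q; last exact: (submD sP).
  have {bE} : b * x = x * a - p - q by exact: bE.
  by move=> bE; rewrite mulrBr [x * b]mulrC bE; ring.
have PF : P `<=` F by exact: addml.
have fin_sT (B : set A^o) n : subm B -> fin (addm B (pow n setT)) setT.
  by move=> sB; exact: fin_add_pow.
have key n : (chi P setT n + chi Q setT (n + c) <= chi P setT (n + c))%N.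
  have [sPn sPc sFc sQc] := And4 (sPp n) (sPp (n + c)%N) (sFp (n + c)%N) (sQp (n + c)%N).
  have PF' : addm P (pow (n + c) setT) `<=` addm F (pow (n + c) setT).
    apply: addm_sub => //; last exact: addmr.
    by apply: subset_trans PF _; exact: addml.
  have [||_] := len_add sPc sFc (@subm_setT _ A^o) PF' (@subsetT _ _).
  - by apply: fin_sub (fin_sT P (n + c)%N sP).
  - exact: fin_sT.
  rewrite /chi => ->; apply: leq_add.
    suff [] : fin (addm P (pow n setT)) [set: A^o] /\
      (len (addm P (pow n setT)) [set: A^o] <=
       len (addm P (pow (n + c) setT)) (addm F (pow (n + c) setT)))%N by [].
    apply: (len_inj (f := homothety x)) => //.
    - by move=> a _; exact: colon.
    - move=> a _; apply: addml => //; apply: addmr => //; exists a => //.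
      by rewrite /scale_by [LHS]mulrC.
    - by apply: fin_sub (fin_sT P (n + c)%N sP).
  apply: len_sub => //; last exact: fin_sT.
  apply: addm_sub => //; last exact: addmr.
  apply: addm_sub; [exact: subm_add|by apply: subset_trans PQ _; exact: addml|].
  by move=> _ [a _ <-]; apply: addml => //; rewrite /scale_by; exact: (submZ a sQ).
have [t' t's gt'] := epoly_size_diff Ps
  (fun n => esym (subnKC (leq_trans (leq_addr _ _) (key n)))).
apply: leq_trans t's; apply: (epoly_size_leq (N := 0) (epoly_size_shift c Qt) gt') => n _.
by rewrite leq_subRL ?key // (leq_trans (leq_addr _ _) (key n)).
Qed.

Lemma chi_prime_size J P : spec J P -> exists s, epoly_size (chi P setT) s.
Proof. by move=> JP; apply: chi_poly => //; exact: spec_subm JP. Qed.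

Lemma chi_lower J (F : nat -> set A^o) d s :
  (forall i, (i <= d)%N -> spec J (F i)) -> (forall i, (i < d)%N -> F i `<` F i.+1) ->
  epoly_size (chi (F 0%N) setT) s -> (d < s)%N.
Proof.
elim: d F s => [|d IH] F s FJ FS F0s.
  apply: (epoly_size_gt0 F0s) => n; have JF := FJ 0%N isT.
  by apply: chi_not0; [exact: spec_subm JF|exact: spec_proper JF].
have [t F1t] := chi_prime_size (FJ 1%N isT).
have dt : (d < t)%N.
  apply: (IH (fun i => F i.+1)) F1t => i id; first exact: FJ.
  exact: FS.
have [F01 F10] := FS 0%N isT.
have := prime_drop (FJ 0%N isT) (spec_subm (FJ 1%N isT)) F01 F10 F0s F1t.
by move/(leq_trans dt); case: (s).
Qed.

(** A prime over the annihilator of M contains the annihilator of some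
    generator e of M, so that A/P is a quotient of the submodule A e. *)
Lemma chi_module (M : lmodType A) P s t : noeth M -> fin_gen M ->
  spec (@annihilator A M) P -> epoly_size (fun n => len (pow n [set: M]) setT) s ->
  epoly_size (chi P setT) t -> (t <= s)%N.
Proof.
move=> noethM [g gE] MP Ms Pt; have sP := spec_subm MP.
have gT x : gspan [set` g] x by apply/gspanE; rewrite gE.
have [e eP] : exists e : M, forall a, (a : A) *: e = 0 -> P a.
  apply: contrapT => ne.
  suff [a [Pa a0]] : exists a : A, ~ P a /\ forall x, x \in g -> a *: x = 0.
    apply: Pa; have [_ _] := MP; apply => x.
    suff : gspan [set` g] `<=` homothety a @^-1` [set 0] by apply; exact: gT.
    apply: gspan_sub; first exact: subm_preim.
    by move=> y /a0.
  elim: (g : seq M) => [|e h [a [Pa a0]]]; first by exists 1; split=> //; exact: spec_proper MP.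
  have [b [be Pb]] : exists b : A, b *: e = 0 /\ ~ P b.
    apply: contrapT => nb; apply: ne; exists e => b be; apply: contrapT => Pb.
    by apply: nb; exists b.
  exists (a * b); split=> [/(spec_prime MP)[]//|x].
  rewrite inE => /orP[/eqP ->|/a0 ax]; first by rewrite -scalerA be scaler0.
  by rewrite mulrC -scalerA ax scaler0.
pose N := scale_by e @` setT; have sN : subm N by exact: subm_im.
have sp (E : lmodType A) n : subm (pow n [set: E]) by exact: subm_powI.
have [c cP] := artin_rees noethM Ixs sN.
apply: (epoly_size_leq (N := 0) Pt (epoly_size_shift c Ms)) => n _.
suff [] : fin (addm P (pow n setT)) [set: A^o] /\
  (len (addm P (pow n setT)) setT <= len (pow (n + c) [set: M]) setT)%N by [].
apply: (len_inj (f := scale_by e)) => //; first exact: subm_add.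
- move=> a _ pa; have : (N `&` pow (n + c) setT) (scale_by e a) by split=> //; exists a.
  rewrite cP => Na.
  have {}Na := @powIS _ _ (mset I) n _ N (@subIsetl _ _ _) _ Na.
  have [b pb bE] : exists2 b, pow n [set: A^o] b & scale_by e b = scale_by e a.
    by apply: (powI_lift (V := N)) => //; move=> _ [b _ <-]; exists b.
  rewrite -(subrK b a); apply: mem_addm => //; apply: eP.
  by move/eqP: bE; rewrite eq_sym -subr_eq0 -raddfB => /eqP.
- by apply: (@fin_pow M noethM _ _ (n + c)).
Qed.

(** A supremum that is positive is attained, since [nat_sup] is 0 on unbounded
    sets. *)
Lemma krull_dim_chains (M : lmodType A) : (0 < krull_dim M)%N ->
  chain_lengths (spec (@annihilator A M)) (krull_dim M) /\
  ~ chain_lengths (spec (@annihilator A M)) (krull_dim M).+1.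
Proof.
rewrite /krull_dim /nat_sup; case: xgetP => [n -> [cn nmax] _|//].
by split=> // /nmax; rewrite ltnn.
Qed.

Lemma hilbert_samuel_upper (M E : lmodType A) : (0 < krull_dim M)%N -> noeth E ->
  fin_gen E -> (forall a (x : E), annihilator M a -> a *: x = 0) ->
  exists C, forall n, (len (pow n [set: E]) setT <= C * n.+1 ^ krull_dim M)%N.
Proof.
move=> /krull_dim_chains[_ nch] noethE [g gE] annE.
have gT x : gspan [set` g] x by apply/gspanE; rewrite gE.
have sann : @subm A A^o (annihilator M).
  split=> [x|a x y ax ay z]; first by rewrite scale0r.
  by rewrite scalerDl -scalerA ax ay scaler0 addr0.
have [C CP] := chi_upper sann nch; exists (size g * C)%N => n.
by rewrite -mulnA; apply: leq_trans (chi_gens _ noethE sann _ gT) _; rewrite ?leq_mul2l ?CP ?orbT.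
Qed.

Lemma pow_chi0 (F : lmodType A) (W : set F) n : subm W ->
  chi [set 0%R] W n = len (pow n W) W.
Proof.
move=> sW; have sn : subm (pow n W) by exact: subm_powI.
rewrite /chi; congr (len _ _); apply/seteqP; split; last exact: addmr.
by apply: addm_sub => // x ->; exact: (subm0 sn).
Qed.

Lemma set1_sub (F : lmodType A) (W : set F) : subm W -> [set 0] `<=` W.
Proof. by move=> sW x ->; exact: subm0. Qed.

Lemma hilbert_samuel_degree (M : lmodType A) : (0 < krull_dim M)%N -> noeth M ->
  fin_gen M -> epoly_size (fun n => len (pow n [set: M]) setT) (krull_dim M).+1.
Proof.
move=> M0 noethM fgM; have [[F [FI FS]] nch] := krull_dim_chains M0.
have [s Ms] : exists s, epoly_size (fun n => len (pow n [set: M]) setT) s.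
  have [s [p [sp [N pN]]]] := chi_poly noethM (@subm_set1 _ M) (@subm_setT _ M) (@subsetT _ _).
  by exists s, p; split=> //; exists N => n /pN <-; rewrite pow_chi0.
suff -> : (krull_dim M).+1 = s by [].
apply/eqP; rewrite eqn_leq; apply/andP; split.
  have [t Ft] := chi_prime_size (FI 0%N isT).
  by apply: leq_trans (chi_lower FI FS Ft) _; exact: chi_module noethM fgM (FI 0%N isT) Ms Ft.
have [C CP] := hilbert_samuel_upper M0 noethM fgM (fun a x aM => aM x).
exact: epoly_size_bound Ms CP.
Qed.

End HilbertSamuel.

(** * Tensor products *)

Section TensorFacts.
Variable A : comNzRingType.
Implicit Types (P N : lmodType A).

(** A map that kills all pure tensors is zero; apply this to the projection
    modulo S. *)
Lemma tensor_ind P N (S : set (tensor P N)) : subm S ->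
  (forall x y, S (tens x y)) -> forall t, S t.
Proof.
move=> sS Stens t.
have cS : submod_closed (mem S) by apply/subm_closedE.
pose b := GRing.isSubmodClosed.Build A (tensor P N) (mem S) cS.
pose W := HB.pack_for (submodClosed (tensor P N)) (mem S : tensor P N -> bool) b.
have piS : forall t, quot_pi W t = (\0 : {linear tensor P N -> quotmod W}) t.
  apply: tensor_ext => x y; apply/eqP; rewrite [_ == _]quot_pi_eq0.
  exact: (mem_set (Stens x y)).
by have /eqP := piS t; rewrite [_ == _]quot_pi_eq0 => /set_mem.
Qed.

Section RightMap.
Variables (P N N' : lmodType A) (g : {linear N -> N'}).

Definition tens_of (x : P) (y : N) : tensor P N := tens x y.

Lemma tens_of_linear x : linear (tens_of x).
Proof. by move=> a y y'; rewrite /tens_of tensPr. Qed.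

HB.instance Definition _ x :=
  GRing.isLinear.Build A N (tensor P N) *:%R (tens_of x) (tens_of_linear x).

Definition tensor_mapr : tensor P N -> tensor P N' := tensor_lift (fun x y => tens x (g y)).

Let linl y : linear (fun x : P => tens x (g y) : tensor P N').
Proof. by move=> a x x'; rewrite tensPl. Qed.

Let linr x : linear (fun y => tens x (g y) : tensor P N').
Proof. by move=> a y y'; rewrite linearP tensPr. Qed.

Lemma tensor_mapr_linear : linear tensor_mapr.
Proof. exact: tensor_lift_linear. Qed.

HB.instance Definition _ := GRing.isLinear.Build A (tensor P N) (tensor P N') *:%R
  tensor_mapr tensor_mapr_linear.

Lemma tensor_mapr_tens x y : tensor_mapr (tens x y) = tens x (g y).
Proof. exact: tensor_lift_tens. Qed.

End RightMap.

Lemma tensor_map_mapr (P Q N N' : lmodType A) (f : {linear P -> Q}) (g : {linear N -> N'}) :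
  forall t : tensor P N,
  tensor_map (N := N') f (tensor_mapr g t) = tensor_mapr g (tensor_map (N := N) f t).
Proof.
apply: (@tensor_ext _ _ _ _ (tensor_map (N := N') f \o @tensor_mapr P _ _ g)
  (@tensor_mapr Q _ _ g \o tensor_map (N := N) f)) => x y /=.
by rewrite tensor_mapr_tens [LHS]tensor_map_tens [tensor_map _ _]tensor_map_tens tensor_mapr_tens.
Qed.

Section Contraction.
Variables (P N : lmodType A) (phi : {linear P -> A^o}).

Definition tensor_eval : tensor P N -> N := tensor_lift (fun x y => (phi x : A) *: y).

Let linl (y : N) : linear (fun x : P => (phi x : A) *: y).
Proof. by move=> a x x'; rewrite linearP scalerDl scalerA. Qed.

Let linr x : linear (fun y : N => (phi x : A) *: y).
Proof. by move=> a y y'; rewrite scalerDr !scalerA mulrC. Qed.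

Lemma tensor_eval_linear : linear tensor_eval.
Proof. exact: tensor_lift_linear. Qed.

HB.instance Definition _ := GRing.isLinear.Build A (tensor P N) N *:%R
  tensor_eval tensor_eval_linear.

Lemma tensor_eval_tens x y : tensor_eval (tens x y) = (phi x : A) *: y.
Proof. exact: tensor_lift_tens. Qed.

End Contraction.

Lemma tens0l P N (y : N) : tens (0 : P) y = 0.
Proof. by rewrite -(addNr (0 : P)) -scaleN1r tensPl scaleN1r addNr. Qed.

Lemma tensZl P N (a : A) (x : P) (y : N) : tens (a *: x) y = a *: tens x y.
Proof. by rewrite -[a *: x]addr0 tensPl tens0l addr0. Qed.

Lemma tensDl P N (x x' : P) (y : N) : tens (x + x') y = tens x y + tens x' y.
Proof. by rewrite -[x]scale1r tensPl !scale1r. Qed.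

Lemma tensZr P N (a : A) (x : P) (y : N) : tens x (a *: y) = a *: tens x y.
Proof. by rewrite -[LHS]/(tens_of x (a *: y)) linearZ. Qed.

Lemma tensor_fin_gen P N : fin_gen P -> fin_gen N -> fin_gen (tensor P N).
Proof.
move=> [s sE] [t tE].
have sT x : gspan [set` s] x by apply/gspanE; rewrite sE.
have tT x : gspan [set` t] x by apply/gspanE; rewrite tE.
exists [seq tens x y | x <- s, y <- t] => z; apply/idP => /=; apply/gspanE.
set S := gspan _; have sS : subm S by exact: subm_gspan.
apply: (tensor_ind sS) => x y {z}.
elim: (sT x) => [|a x0 x' xs _ IH]; first by rewrite tens0l; exact: subm0.
rewrite tensDl tensZl; apply: submD => //; apply: submZ => //.
elim: (tT y) => [|b y0 y' yt _ IHy]; first by rewrite -[tens _ _]/(tens_of x0 0) raddf0; exact: subm0.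
rewrite -[tens _ _]/(tens_of x0 (b *: y0 + y')) linearP; apply: submD => //; apply: submZ => //.
apply: sub_gspan; apply/allpairsP; by exists (x0, y0).
Qed.

Lemma tensor_ann P N (a : A) : (forall y : N, a *: y = 0) -> forall t : tensor P N, a *: t = 0.
Proof.
move=> aN; apply: (@tensor_ind P N (homothety a @^-1` [set 0])).
  exact: subm_preim.
by move=> x y; rewrite /= /homothety -tensZr aN -[tens _ _]/(tens_of x 0) raddf0.
Qed.

End TensorFacts.

(** * Reduction modulo powers of an ideal *)

Section Reduction.
Variables (A : comNzRingType) (I : idealr A).

Lemma ideal_powE n : ideal_pow I n = powI (mset I) n [set: A^o].
Proof.
elim: n => [//|n IH] /=; apply/seteqP; split=> x.
  move=> /gspanE; apply: gspan_sub => // _ [a [b [aI bI ->]]].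
  by apply: mem_mulI => //; move: (set_mem bI); rewrite IH.
move=> Sx; apply/gspanE; apply: mulI_sub Sx => // a y Ia Jy.
by apply: sub_gspan; exists a, y; split=> //; apply/mem_set; rewrite IH.
Qed.

Lemma pow_submodE (M : lmodType A) n (x : M) :
  x \in pow_submod I M n <-> powI (mset I) n [set: M] x.
Proof.
split=> [/gspanE|].
  apply: gspan_sub; first exact: subm_powI.
  move=> _ [a [y [/set_mem aI ->]]]; rewrite ideal_powE in aI.
  exact: (powI_map (f := scale_by y) _ aI).
move=> Ix; apply/gspanE.
elim: n x Ix => [|n IH] x.
  by move=> _; apply: sub_gspan; exists 1, x; rewrite scale1r; split=> //; apply/mem_set.
apply: mulI_sub => // a y Ia /IH Sy.
suff : gspan [set z | exists b (w : M), b \in ideal_pow I n /\ z = b *: w] `<=`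
  homothety a @^-1` gspan [set z | exists b (w : M), b \in ideal_pow I n.+1 /\ z = b *: w].
  by apply.
apply: gspan_sub; first exact: subm_preim.
move=> _ [b [w [/set_mem bI ->]]]; rewrite /= /homothety scalerA.
apply: sub_gspan; exists (a * b), w; split=> //; apply/mem_set.
rewrite ideal_powE in bI; have := @mem_mulI _ A^o (mset I) _ a b Ia bI.
by rewrite -[mulI _ _]/(powI (mset I) n.+1 [set: A^o]) -ideal_powE.
Qed.

Variables (P M : lmodType A) (n : nat).
Local Notation N := (quotmod (pow_submod I M n)).

Definition reduce : tensor P M -> tensor P N := tensor_mapr (@quot_pi _ _ (pow_submod I M n)).
HB.instance Definition _ := GRing.Linear.on reduce.

Lemma reduce_surj (t : tensor P N) : exists u, reduce u = t.
Proof.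
have := @tensor_ind _ P N (reduce @` setT) (subm_im _ (@subm_setT _ _)) _ t.
by case=> [x y|u _ <-]; [exists (tens x (repr y)) => //; rewrite [LHS]tensor_mapr_tens /= quot_pi_reprK|exists u].
Qed.

Lemma pow_tens n' x (y : M) : powI (mset I) n' [set: M] y ->
  powI (mset I) n' [set: tensor P M] (tens x y).
Proof. exact: (powI_map (f := tens_of x)). Qed.

(** Right exactness of the tensor product: modulo I^n, [reduce] has an inverse,
    which sends x (x) [y] to the class of x (x) y. *)
Lemma reduce_ker (t : tensor P M) :
  reduce t = 0 <-> powI (mset I) n [set: tensor P M] t.
Proof.
pose Q := quotmod (pow_submod I (tensor P M) n).
pose b (x : P) (u : N) : Q := quot_pi _ (tens x (repr u)).
have bl u : linear (b^~ u) by move=> a x x'; rewrite /b tensPl linearP.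
have brE x y : b x (quot_pi _ y) = quot_pi _ (tens x y).
  apply/eqP; rewrite -subr_eq0 -raddfB quot_pi_eq0; apply/pow_submodE.
  rewrite -[tens x (repr _)]/(tens_of x _) -[tens x y]/(tens_of x y) -raddfB.
  apply: pow_tens; apply/pow_submodE.
  by rewrite -quot_pi_eq0 raddfB /= quot_pi_reprK subrr.
have br x : linear (b x).
  move=> a u u'; rewrite -[u]quot_pi_reprK -[u']quot_pi_reprK -linearP !brE.
  by rewrite tensPr linearP.
have theta_lin := tensor_lift_linear bl br.
pose theta : {linear tensor P N -> Q} :=
  HB.pack (tensor_lift b) (GRing.isLinear.Build A (tensor P N) Q *:%R _ theta_lin).
have thetaE u : theta (reduce u) = quot_pi _ u.
  apply: (tensor_ext (f := theta \o reduce)) => x y /=.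
  by rewrite [reduce _]tensor_mapr_tens -brE; exact: tensor_lift_tens.
split=> [t0|].
  by apply/pow_submodE; rewrite -quot_pi_eq0 -thetaE t0 raddf0.
suff : powI (mset I) n [set: tensor P M] `<=` gspan [set z | exists x y, powI (mset I) n [set: M] y /\ z = tens x y].
  move=> /(_ t) H /H; apply: (gspan_sub (W := reduce @^-1` [set 0])); first exact: subm_preim.
  move=> _ [x [y [py ->]]]; rewrite /= [LHS]tensor_mapr_tens /=.
  have -> : quot_pi (pow_submod I M n) y = 0 by apply/eqP; rewrite quot_pi_eq0; apply/pow_submodE.
  by rewrite -[LHS]/(tens_of x 0) raddf0.
clear; elim: n => [|k IH].
  move=> t _; apply: tensor_ind t => // x y; apply: sub_gspan; by exists x, y.
apply: mulI_sub => // a t Ia /IH.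
move=> Ht; suff : gspan [set z | exists (x : P) y, powI (mset I) k [set: M] y /\ z = tens x y] `<=`
  homothety a @^-1` gspan [set z | exists (x : P) y, powI (mset I) k.+1 [set: M] y /\ z = tens x y] by apply.
apply: gspan_sub; first exact: subm_preim.
move=> _ [x [y [py ->]]].
have E : homothety a (tens x y) = tens x (a *: y) by rewrite tensZr.
apply: sub_gspan; exists x, (a *: y); split; last exact: E.
exact: mem_mulI.
Qed.

End Reduction.

(** * Lengths of cohomology modules *)

Section CohomologyLength.
Variables (A : comNzRingType).

Definition boundaries (Y : complex A) i : set (Y i) := diff Y (i - 1) i @` setT.
Definition cycles (Y : complex A) i : set (Y i) := diff Y i (i + 1) @^-1` [set 0].

Lemma subm_boundaries Y i : subm (@boundaries Y i). Proof. exact: subm_im. Qed.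
Lemma subm_cycles Y i : subm (@cycles Y i). Proof. exact: subm_preim. Qed.

Lemma boundaries_cycles Y i : @boundaries Y i `<=` @cycles Y i.
Proof. by move=> _ [x _ <-]; rewrite /cycles /= diff_diff. Qed.

Lemma lengthE (H : lmodType A) : length H = len [set 0] [set: H].
Proof.
congr nat_sup; congr chain_lengths; apply/seteqP; split=> W /=.
  by move/subm_closedE => sW; split=> // x ->; exact: subm0.
by case=> sW _ _; apply/subm_closedE.
Qed.

Lemma finite_lengthE (H : lmodType A) : finite_length H <-> fin [set 0] [set: H].
Proof.
suff -> : fin [set 0] [set: H] = finite_length H by [].
congr (exists n, _); apply/funext => n; congr (forall k, _); apply/funext => k.
congr (chain_lengths _ _ -> _); apply/seteqP; split=> W /=.
  by case=> sW _ _; apply/subm_closedE.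
by move/subm_closedE => sW; split=> // x ->; exact: subm0.
Qed.

(** The cocycles embed into Y i and project onto the cohomology; compare the
    three intervals of submodules. *)
Lemma cohomology_len (Y : complex A) i :
  (fin (@boundaries Y i) (@cycles Y i) <-> finite_length (cohomology Y i)) /\
  (fin (@boundaries Y i) (@cycles Y i) ->
     length (cohomology Y i) = len (@boundaries Y i) (@cycles Y i)).
Proof.
set B := @boundaries Y i; set Z := @cycles Y i.
pose C : lmodType A := submod_type (lin_ker (diff Y i (i + 1))).
pose iota : {linear C -> Y i} := (\val : C -> Y i).
pose V : set C := iota @^-1` B.
have sB : subm B by exact: subm_boundaries.
have sZ : subm Z by exact: subm_cycles.
have BZ : B `<=` Z by exact: boundaries_cycles.
have sV : subm V by exact: subm_preim.
have inC z : Z z -> exists c : C, iota c = z.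
  by move=> Zz; exists (SubmodType (introT eqP Zz : z \in lin_ker (diff Y i (i + 1)))).
have CZ (c : C) : Z (iota c).
  by case: c => z zP; exact: (eqP zP).
have VB (c : C) : V c <-> (c \in @coboundary A Y i).
  rewrite /V /B /boundaries /=; split=> [[x _ xc]|/asboolP[x xc]]; last by exists x.
  by apply/asboolP; exists x.
pose H : lmodType A := cohomology Y i.
pose pi : {linear C -> H} := @quot_pi _ _ (@coboundary A Y i).
have piE c : pi c = 0 <-> V c.
  by rewrite VB -quot_pi_eq0; split=> [->|/eqP].
have pi_surj (h : H) : exists c, pi c = h by exists (repr h); exact: quot_pi_reprK.
have inj1 : fin B Z -> fin V setT /\ (len V setT <= len B Z)%N.
  by apply: (len_inj (f := iota)).
have surj1 : fin V setT -> fin B Z /\ (len B Z <= len V setT)%N.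
  apply: (len_surj (f := iota)) => // z /inC[c cz]; exists c => //.
  by rewrite cz subrr; exact: subm0.
have inj2 : fin [set 0%R] [set: H] -> fin V setT /\ (len V setT <= len [set 0%R] [set: H])%N.
  by apply: (len_inj (f := pi)) => // c _ /piE.
have surj2 : fin V setT -> fin [set 0%R] [set: H] /\ (len [set 0%R] [set: H] <= len V setT)%N.
  apply: (len_surj (f := pi)) => //; first by move=> c /piE.
  by move=> h _; have [c <-] := pi_surj h; exists c => //; rewrite subrr.
split; first by rewrite (finite_lengthE H); split=> [/inj1[/surj2[]]|/inj2[/surj1[]]].
move=> fBZ; have [fV le1] := inj1 fBZ; have [fH le2] := surj2 fV.
have [_ le3] := inj2 fH; have [_ le4] := surj1 fV.
by apply/eqP; rewrite (lengthE H) eqn_leq (leq_trans le2 le1) (leq_trans le4 le3).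
Qed.

(** The maps r form a surjection of complexes with kernel K, under which the
    cycles and the boundaries of d have the inverse images written here. *)
Lemma len_reduction (T0 T1 T2 N0 N1 N2 : lmodType A)
    (D0 : {linear T0 -> T1}) (D1 : {linear T1 -> T2})
    (d0 : {linear N0 -> N1}) (d1 : {linear N1 -> N2})
    (r0 : {linear T0 -> N0}) (r1 : {linear T1 -> N1}) (r2 : {linear T2 -> N2})
    (K1 : set T1) (K2 : set T2) : subm K1 -> subm K2 ->
  (forall t, d0 (r0 t) = r1 (D0 t)) -> (forall t, d1 (r1 t) = r2 (D1 t)) ->
  (forall z, exists u, r0 u = z) -> (forall z, exists u, r1 u = z) ->
  (forall t, r1 t = 0 <-> K1 t) -> (forall t, r2 t = 0 <-> K2 t) ->
  d0 @` setT `<=` d1 @^-1` [set 0] ->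
  addm (D0 @` setT) K1 `<=` D1 @^-1` K2 ->
  fin (addm (D0 @` setT) K1) (D1 @^-1` K2) ->
  fin (d0 @` setT) (d1 @^-1` [set 0]) /\
  len (d0 @` setT) (d1 @^-1` [set 0]) = len (addm (D0 @` setT) K1) (D1 @^-1` K2).
Proof.
move=> sK1 sK2 dr0 dr1 surj0 surj1 k1 k2 bz vu fVU.
have sV : subm (addm (D0 @` setT) K1) by apply: subm_add => //; exact: subm_im.
have sU : subm (D1 @^-1` K2) by exact: subm_preim.
have sB : subm (d0 @` setT) by exact: subm_im.
have sZ : subm (d1 @^-1` [set 0]) by exact: subm_preim.
have [fBZ le1] : fin (d0 @` setT) (d1 @^-1` [set 0]) /\
    (len (d0 @` setT) (d1 @^-1` [set 0%R]) <= len (addm (D0 @` setT) K1) (D1 @^-1` K2))%N.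
  apply: (len_surj (f := r1)) => //.
    move=> v [_ [t _ <-] /k1 pv]; exists (r0 t) => //.
    by rewrite dr0; apply/esym/eqP; rewrite -subr_eq0 -raddfB /= pv.
  move=> z; have [u <-] := surj1 z; rewrite /= dr1 => /k2 Uu; exists u => //.
  by rewrite subrr; exact: (subm0 sB).
have [_ le2] : fin (addm (D0 @` setT) K1) (D1 @^-1` K2) /\
    (len (addm (D0 @` setT) K1) (D1 @^-1` K2) <= len (d0 @` setT) (d1 @^-1` [set 0%R]))%N.
  apply: (len_inj (f := r1)) => //.
    move=> u Uu [t' _]; have [t <-] := surj0 t'; rewrite dr0 => /eqP.
    rewrite -subr_eq0 -raddfB => /eqP/k1 ptu; exists (D0 t); first by exists t.
    by rewrite -opprB; exact: submN.
  by move=> u /k2 Uu; rewrite /= dr1.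
by split=> //; apply/eqP; rewrite eqn_leq le1.
Qed.

Section Tensored.
Variables (X : complex A) (I : idealr A) (M : lmodType A) (n : nat) (i : int).
Local Notation T j := (tensor (X j) M).
Local Notation pow k U := (powI (mset I) k U).
Local Notation D j k := (diff (tensor_complex X M) j k).

(** [lifted_boundaries] and [lifted_cycles] are the inverse images in X (x) M of
    the boundaries and the cycles of X (x) M/I^n M. *)
Definition lifted_boundaries : set (T i) :=
  addm (@boundaries (tensor_complex X M) i) (pow n [set: T i]).
Definition lifted_cycles : set (T i) := D i (i + 1) @^-1` (pow n [set: T (i + 1)]).

Lemma subm_lifted_boundaries : subm lifted_boundaries.
Proof. by apply: subm_add; [exact: subm_boundaries|exact: subm_powI]. Qed.

Lemma subm_lifted_cycles : subm lifted_cycles.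
Proof. by apply: subm_preim; exact: subm_powI. Qed.

Lemma lifted_boundaries_cycles : lifted_boundaries `<=` lifted_cycles.
Proof.
apply: addm_sub; first exact: subm_lifted_cycles.
  by move=> t /boundaries_cycles Zt; rewrite /lifted_cycles /= Zt; exact: (subm0 (subm_powI _ _ _)).
by move=> t; exact: powI_map.
Qed.

Lemma cohomology_reduction_len : fin lifted_boundaries lifted_cycles ->
  length (cohomology (tensor_complex X (quotmod (pow_submod I M n))) i) =
  len lifted_boundaries lifted_cycles.
Proof.
set N := quotmod _; set XN := tensor_complex X N => fVU.
have [fBZ <-] := len_reduction (r0 := @reduce A I (X (i - 1)) M n)
  (d0 := diff XN (i - 1) i) (d1 := diff XN i (i + 1))
  (subm_powI _ _ (@subm_setT _ _)) (subm_powI _ _ (@subm_setT _ _))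
  (@tensor_map_mapr _ _ _ _ _ (diff X (i - 1) i) _)
  (@tensor_map_mapr _ _ _ _ _ (diff X i (i + 1)) _)
  (@reduce_surj _ _ _ _ _) (@reduce_surj _ _ _ _ _)
  (@reduce_ker _ _ _ _ _) (@reduce_ker _ _ _ _ _)
  (@boundaries_cycles XN i) lifted_boundaries_cycles fVU.
exact: (cohomology_len XN i).2.
Qed.

End Tensored.

End CohomologyLength.

(** * Projective modules over a local ring *)

Section Projective.
Variable A : comNzRingType.

(** Lift against the corestriction of g to its image. *)
Lemma projective_lift (P V W : lmodType A) (g : {linear V -> W}) (f : {linear P -> W}) :
  projective P -> (forall x, exists v, g v = f x) ->
  exists h : {linear P -> V}, forall x, g (h x) = f x.
Proof.
move=> projP fg.
pose W0 : lmodType A := submod_type (lin_im g).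
have gin v : g v \in lin_im g by apply/asboolP; exists v.
have fin x : f x \in lin_im g by apply/asboolP; exact: fg.
pose gc v : W0 := SubmodType (gin v); pose fc x : W0 := SubmodType (fin x).
have gc_lin : linear gc by move=> a x y; apply: val_inj; rewrite [RHS]raddfD [X in _ = X + _]linearZ /= linearP.
have fc_lin : linear fc by move=> a x y; apply: val_inj; rewrite [RHS]raddfD [X in _ = X + _]linearZ /= linearP.
pose gl : {linear V -> W0} := HB.pack gc (GRing.isLinear.Build A V W0 *:%R gc gc_lin).
pose fl : {linear P -> W0} := HB.pack fc (GRing.isLinear.Build A P W0 *:%R fc fc_lin).
have [w|h hP] := projP V W0 gl fl.
  by have /asboolP[v vw] := valP w; exists v; apply: val_inj.
by exists h => x; exact: (congr1 val (hP x)).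
Qed.

End Projective.

Section LocalProjective.
Variables (A : comNzRingType) (m : idealr A).
Hypotheses (noethA : noeth A^o) (A_local : local_ring m).

Local Notation mm := (mulI (mset m) setT).

(** A projective P is a direct summand of the free module on its own elements;
    if x is not in m P, one of its coordinates there is a unit. *)
Lemma projective_functional (P : lmodType A) (x : P) : projective P -> ~ mm x ->
  exists phi : {linear P -> A^o}, phi x = 1.
Proof.
move=> projP nx.
have [|h hP] := @projective_lift _ _ _ _ (@fglift A P P id) (idfun : {linear P -> P}) projP.
  by move=> y; exists << y >>; rewrite /= liftU scale1r.
have [k kP] : exists k, coeff k (h x) \notin m.
  apply: contrapT => nk; apply: nx; rewrite -[x](hP x) -[h x]freeg_sumE linear_sum.
  elim: (dom (h x)) => [|k r IH]; first by rewrite big_nil; exact: subm0.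
  rewrite big_cons; apply: submD => //; rewrite /= liftU; apply: mem_mulI => //.
  by apply: contrapT => nmk; apply: nk; exists k; apply/negP.
have [c cP] := unit_notin_m noethA A_local kP.
pose phi y : A^o := c * coeff k (h y).
have phi_lin : linear phi.
  by move=> a y z; rewrite /phi linearD linearZ /= coeffD coeffZ mulrDr mulrCA.
pose phil : {linear P -> A^o} := HB.pack phi (GRing.isLinear.Build A P A^o *:%R phi phi_lin).
by exists phil.
Qed.

(** Gaussian elimination: as long as the image of e has an element x outside m X, the
    functional psi with psi (d x) = 1 splits off the line spanned by x, and the
    kernel of e grows.  At the end the image of e lies in m X, hence is zero. *)
Lemma split_injection (X Y : lmodType A) (d : {linear X -> Y}) (e : {linear X -> X}) :
  noeth X -> projective Y -> (forall v, e (e v) = e v) ->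
  (forall x, e x = x -> mm (d x) -> mm x) ->
  exists h : {linear Y -> X}, forall v, h (d (e v)) = e v.
Proof.
move=> noethX projY ee soft.
suff main : forall W : set X, subm W -> forall e : {linear X -> X},
    W = e @^-1` [set 0] -> (forall v, e (e v) = e v) ->
    (forall x, e x = x -> mm (d x) -> mm x) ->
    exists h : {linear Y -> X}, forall v, h (d (e v)) = e v.
  by apply: (main (e @^-1` [set 0])) => //; exact: subm_preim.
clear e ee soft; apply: (acc_ind noethX) => W sW IH e WE ee soft.
(* If the image of e lies in m X, it equals m times itself. *)
have [eX|] := pselect (forall x, e x = x -> mm x).
  have e0 : e @` setT `<=` [set 0].
    apply: (nakayama noethA A_local noethX) => //; first exact: subm_im.
      by move=> _ ->; exists 0; rewrite ?raddf0.
    apply: subset_trans (addmr (@subm_set1 _ X)) => _ [v _ <-].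
    have S x : mm x -> mulI (mset m) (e @` setT) (e x).
      move=> mx; apply: (mulI_sub (U := e @^-1` mulI (mset m) (e @` setT))) mx.
        exact: subm_preim.
      by move=> a y ma _; rewrite /= linearZ; apply: mem_mulI => //; exists y.
    by rewrite -ee; apply/S/eX/ee.
  by exists \0 => v; rewrite (e0 (e v)) //; exists v.
move=> /existsNP[x /not_implyP[ex nmx]].
have [|psi psi1] := @projective_functional Y (d x) projY; first by move/(soft x ex).
pose e' v := e v - (psi (d (e v)) : A) *: x.
have e'_lin : linear e'.
  move=> a v w; rewrite /e' !linearP /= scalerDl -scalerA opprD addrACA.
  by rewrite -scalerBr.
pose el : {linear X -> X} := HB.pack e' (GRing.isLinear.Build A X X *:%R e' e'_lin).
have e'x : e' x = 0 by rewrite /e' ex psi1 scale1r subrr.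
have ee' v : e (e' v) = e' v by rewrite /e' linearB linearZ /= ee ex.
have psi' v : psi (d (e' v)) = 0.
  by rewrite /e' !linearB !linearZ /= psi1 [_ *: _]mulrN1 subrr.
have e'e' v : e' (e' v) = e' v by rewrite {1}/e' ee' psi' scale0r subr0.
have [||||h hP] := IH (el @^-1` [set 0]) _ _ _ el erefl e'e'.
- exact: subm_preim.
- by rewrite WE => v /= ev; rewrite /= /e' ev !linear0 scale0r subr0.
- move=> /(_ x e'x); rewrite WE /= ex => x0; apply: nmx; rewrite x0; exact: subm0.
- by move=> y ey; apply: soft; rewrite -{1}ey ee'.
pose h' y := h y + (psi y : A) *: (x - h (d x)).
have h'_lin : linear h'.
  by move=> a y z; rewrite /h' !linearP /= scalerDl -scalerA addrACA -scalerDr.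
pose hl : {linear Y -> X} := HB.pack h' (GRing.isLinear.Build A Y X *:%R h' h'_lin).
exists hl => v; rewrite /= /h'.
have evE : e v = e' v + (psi (d (e v)) : A) *: x by rewrite /e' subrK.
set c := psi _ in evE *; have hev : h (d (e' v)) = e' v by exact: hP.
rewrite {1}evE linearD linearZ linearD linearZ /= hev scalerBr.
by rewrite [RHS]evE -!addrA [_ + (_ - _)]addrC subrK.
Qed.

End LocalProjective.

(** * Homotopies *)

Section Homotopies.
Variables (A : comNzRingType) (m : idealr A) (X : complex A).
Hypotheses (noethA : noeth A^o) (A_local : local_ring m).
Hypothesis X_bounded : bounded_complex X.
Hypothesis X_proj : forall i, projective (X i).
Hypothesis X_noeth : forall i, noeth (X i).

Local Notation mm := (mulI (mset m) setT).

(** [contracts i a h]: in degree i, h is a null-homotopy of multiplication by a.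
    The indices j and k are free so that no transport along i + 1 - 1 = i is
    needed. *)
Definition contracts i (a : A) (h : forall i j, {linear X i -> X j}) :=
  forall j k, j = i + 1 -> k = i - 1 ->
  forall x : X i, a *: x = h j i (diff X i j x) + diff X k i (h i k x).

Lemma redefine (h : forall i j, {linear X i -> X j}) p q (s : {linear X p -> X q}) :
  exists h' : forall i j, {linear X i -> X j}, h' p q = s /\
    forall i j, (i, j) <> (p, q) -> h' i j = h i j.
Proof.
(* Stated with transports, the choice can be made for each (i, j) separately. *)
have H i j : exists k : {linear X i -> X j},
    (forall (ei : p = i) (ej : q = j),
       k = eq_rect q (fun j => {linear X i -> X j})
             (eq_rect p (fun i => {linear X i -> X q}) s i ei) j ej) /\
    ((i, j) <> (p, q) -> k = h i j).
  have [[ip jq]|npq] := pselect ((i, j) = (p, q)); last first.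
    by exists (h i j); split=> // ei ej; case: npq; rewrite ei ej.
  rewrite ip jq; exists s; split=> // ei ej.
  by rewrite (eq_irrelevance ei erefl) (eq_irrelevance ej erefl).
exists (fun i j => sval (cid (H i j))); split=> [|i j ij].
  by have [/(_ erefl erefl)] := svalP (cid (H p q)).
by have [_ ->] := svalP (cid (H i j)).
Qed.

Lemma bounded_below : exists b : nat, forall i : int, (i < - b%:Z)%R -> forall x : X i, x = 0.
Proof.
have [b bP] := X_bounded; exists b => i ib; apply: bP.
by rewrite ltr0_norm; lia.
Qed.

Lemma bounded_above : exists b : nat, forall i : int, (b%:Z < i)%R -> forall x : X i, x = 0.
Proof.
have [b bP] := X_bounded; exists b => i ib; apply: bP.
by rewrite gtr0_norm; lia.
Qed.

(** The submodules B + a^l Z stop descending, and at that point Nakayama's lemma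
    shows that a^l Z lies in B. *)
Lemma cycles_torsion a i : a \in m -> finite_length (cohomology X i) ->
  exists l, forall z, @cycles A X i z -> @boundaries A X i (a ^+ l *: z).
Proof.
move=> ma /(cohomology_len X i).1 fBZ.
set B := @boundaries A X i in fBZ *; set Z := @cycles A X i in fBZ *.
have sB : subm B by exact: subm_boundaries.
have sZ : subm Z by exact: subm_cycles.
have BZ : B `<=` Z by exact: boundaries_cycles.
pose W l := addm B (homothety (a ^+ l) @` Z).
have sa l : subm (homothety (a ^+ l) @` Z : set (X i)) by exact: subm_im.
have sW l : subm (W l) by exact: subm_add.
have BW l : B `<=` W l by exact: addml.
have WZ l : W l `<=` Z by apply: addm_sub => // _ [z Zz <-]; exact: submZ.
have WS l : W l.+1 `<=` W l.
  apply: addm_sub => // _ [z Zz <-]; apply: addmr => //; exists (a *: z); first exact: submZ.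
  by rewrite /homothety scalerA -exprSr.
have [|l lP] := fin_dcc sW BW WS; first exact: fin_sub fBZ.
exists l => z Zz.
have : W l `<=` B.
  apply: (nakayama noethA A_local (@X_noeth i)) => //.
  have smW : subm (addm B (mulI (mset m) (W l))) by exact: subm_add.
  apply: subset_trans lP _; apply: addm_sub => //; first exact: addml.
  move=> _ [y Zy <-]; apply: addmr => //.
  rewrite /homothety exprS -scalerA; apply: mem_mulI => //.
  by apply: addmr => //; exists y.
by apply; apply: addmr => //; exists z.
Qed.

(** Downward induction on the degree from the end where X vanishes: once a^L
    is null-homotopic in degrees above n, its defect in degree n is a map
    into the cycles; a further power of a moves it into the boundaries, along
    which it lifts because X n is projective. *)
Lemma null_homotopy a : a \in m -> (forall i, finite_length (cohomology X i)) ->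
  forall i, exists L h, contracts i (a ^+ L) h.
Proof.
move=> ma Xfin i0; have [b bP] := bounded_above.
have main n : exists L h, forall i, (b%:Z + 1 - n%:Z <= i)%R -> contracts i (a ^+ L) h.
  elim: n => [|n [L [h hP]]].
    exists 0%N, (fun i j => \0) => i bi j k _ _ x.
    have -> : x = 0 by apply: bP; lia.
    by rewrite !linear0 ?scaler0 addr0.
  set p : int := b%:Z + 1 - n.+1%:Z; set q := p - 1.
  have [l lP] := cycles_torsion ma (Xfin p).
  pose defect : {linear X p -> X p} :=
    (homothety (a ^+ l) \o (homothety (a ^+ L) \- (h (p + 1) p \o diff X p (p + 1)))).
  have [|s sP] := @projective_lift _ _ _ _ (diff X q p) defect (@X_proj p).
    move=> x; suff Zx : @cycles A X p (a ^+ L *: x - h (p + 1) p (diff X p (p + 1) x)).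
      by have [v _ vx] := lP _ Zx; exists v; rewrite vx.
    rewrite /cycles /= linearB linearZ /=.
    have := hP (p + 1) _ (p + 1 + 1) p erefl _ (diff X p (p + 1) x).
    rewrite diff_diff linear0 add0r => ->; first by rewrite subrr.
      by rewrite /p; lia.
    by rewrite addrK.
  pose h1 i j : {linear X i -> X j} := homothety (a ^+ l) \o h i j.
  have [h' [h'pq h'P]] := redefine h1 s.
  exists (L + l)%N, h' => i pi j k ji ki x; rewrite exprD mulrC -scalerA.
  have [ip|ip] := eqVneq i p.
    subst i; have kq : k = q by [].
    rewrite kq h'pq h'P; last by case; rewrite ji /q; lia.
    by rewrite sP /= /homothety ji -scalerDr addrC subrK.
  rewrite !h'P; try by case; lia.
  rewrite /= /homothety [diff X k i (_ *: _)]linearZ -scalerDr; congr (_ *: _); apply: hP => //.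
  by move: pi ip; rewrite /p; lia.
have [L [h hP]] := main (absz (b%:Z + 1 - i0)%R).
by exists L, h; apply: hP; lia.
Qed.

Lemma cycles_torsion_tensor a (M : lmodType A) : a \in m ->
  (forall i, finite_length (cohomology X i)) ->
  forall i, exists L, forall t, @cycles A (tensor_complex X M) i t ->
    @boundaries A (tensor_complex X M) i (a ^+ L *: t).
Proof.
move=> ma Xfin i; have [L [h hP]] := null_homotopy ma Xfin i; exists L => t Zt.
pose th j k : {linear tensor (X j) M -> tensor (X k) M} := tensor_map (N := M) (h j k).
pose td j k : {linear tensor (X j) M -> tensor (X k) M} := tensor_map (N := M) (diff X j k).
pose rhs : {linear tensor (X i) M -> tensor (X i) M} :=
  (th (i + 1) i \o td i (i + 1)) \+ (td (i - 1) i \o th i (i - 1)).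
have E : homothety (a ^+ L) =1 rhs.
  apply: tensor_ext => x y; rewrite /rhs /= /homothety -tensZl.
  rewrite (hP _ _ erefl erefl) tensDl /th /td.
  by do ?rewrite tensor_map_tens.
exists (th i (i - 1) t) => //; rewrite -[RHS]/(homothety _ t) E /rhs /=.
by have -> : td i (i + 1) t = 0 by []; rewrite linear0 add0r.
Qed.

(** An element x that is a cycle modulo m, but part of a basis of a complement of
    the boundaries; e stands for the projection onto the complement. *)
Definition obstruction i :=
  exists (e : {linear X i -> X i}) (x : X i),
    [/\ forall w : X (i - 1), e (diff X (i - 1) i w) = 0, e x = x,
        mm (diff X i (i + 1) x) & ~ mm x].

(** Upward induction on the degree from the end where X vanishes.  If h contracts
    X below degree p, then e = 1 - d h is an idempotent of X p that kills exactly
    the boundaries, and h extends if the differential is split injective on the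
    image of e. *)
Lemma contraction : (forall i, ~ obstruction i) ->
  exists h, forall i, contracts i 1 h.
Proof.
move=> nobs; have [b bP] := bounded_below; have [c cP] := bounded_above.
have main n : exists h, forall i, (i < n%:Z - b%:Z)%R -> contracts i 1 h.
  elim: n => [|n [h hP]].
    exists (fun i j => \0) => i bi j k _ _ x.
    have -> : x = 0 by apply: bP; lia.
    by rewrite !linear0 ?scaler0 addr0.
  set p : int := n%:Z - b%:Z.
  pose e : {linear X p -> X p} := idfun \- (diff X (p - 1) p \o h p (p - 1)).
  have eE x : e x = x - diff X (p - 1) p (h p (p - 1) x) by [].
  have de w : e (diff X (p - 1) p w) = 0.
    have := hP (p - 1) _ p (p - 1 - 1) _ erefl w; rewrite scale1r => E.
    rewrite eE {1}E ?linearD ?diff_diff ?addr0 ?subrr //; first by rewrite /p; lia.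
    by rewrite subrK.
  have ee x : e (e x) = e x by rewrite [X in e X]eE linearB de subr0.
  have [|s sP] := split_injection noethA A_local (@X_noeth p) (@X_proj (p + 1)) ee
    (d := diff X p (p + 1)).
    move=> x ex mdx; apply: contrapT => nmx; apply: (nobs p).
    by exists e, x.
  have [h' [h'pq h'P]] := redefine h s.
  exists h' => i pi j k ji ki x; rewrite scale1r.
  have [ip|ip] := eqVneq i p.
    subst i; subst j; subst k; rewrite h'pq h'P; last by case; lia.
    have -> : diff X p (p + 1) x = diff X p (p + 1) (e x).
      by rewrite eE linearB diff_diff subr0.
    by rewrite sP eE subrK.
  rewrite !h'P; try by case; lia.
  rewrite -hP ?scale1r //; by move: pi ip; rewrite /p; lia.
have [h hP] := main (b + c).+1; exists h => i; have [ic|ci] := lerP i c%:Z.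
  by apply: hP; lia.
move=> j k _ _ x; have -> : x = 0 by exact: cP.
by rewrite !linear0 ?scaler0 addr0.
Qed.

Lemma nonzero_obstruction : ~ homotopy_equivalent X (zero_complex A) ->
  exists i, obstruction i.
Proof.
move=> nX; apply: contrapT => nobs; apply: nX.
have [|h hP] := contraction; first by move=> i ob; apply: nobs; exists i.
have f0 i j (x : X i) : (\0 : {linear X j -> zero_complex A j}) (diff X i j x) =
    diff (zero_complex A) i j ((\0 : {linear X i -> zero_complex A i}) x) by [].
have g0 i j (x : zero_complex A i) : (\0 : {linear zero_complex A j -> X j}) (diff (zero_complex A) i j x) =
    diff X i j ((\0 : {linear zero_complex A i -> X i}) x) by rewrite /= linear0.
exists (ChainMap f0), (ChainMap g0); split.
  pose h' i j : {linear X i -> X j} := \- h i j.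
  exists h' => i x /=; rewrite linearN sub0r -opprD; congr (- _).
  by rewrite -(hP i (i + 1) (i - 1) erefl erefl x) scale1r.
exists (fun i j => \0) => i x /=; rewrite addr0; apply/rowP; by case.
Qed.

End Homotopies.

(** * Growth of the cohomology modulo powers of an ideal *)

Section ReductionGrowth.
Variables (A : comNzRingType) (m I : idealr A).
Hypotheses (noethA : noeth A^o) (A_local : local_ring m) (I_primary : primary_to m I).
Variable xs : seq A.
Hypothesis Ixs : forall a, mset I a <-> gspan [set` (xs : seq A^o)] a.

Local Notation pow n U := (powI (mset I) n U).

Section TwoTerm.
Variables (E E' : lmodType A) (D : {linear E -> E'}) (B : set E) (d : nat).
Hypotheses (noethE : noeth E) (noethE' : noeth E') (sB : subm B).
Local Notation Z := (D @^-1` [set 0]).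
Hypotheses (BZ : B `<=` Z) (finBZ : fin B Z).
Hypothesis E_growth : exists C, forall n, (len (pow n [set: E]) setT <= C * n.+1 ^ d)%N.
Hypothesis d0 : (0 < d)%N.

Local Notation V n := (addm B (pow n [set: E])).
Local Notation U n := (D @^-1` (pow n [set: E'])).

Let sZ : subm Z. Proof. exact: subm_preim. Qed.
Let spE n : subm (pow n [set: E]). Proof. exact: subm_powI. Qed.
Let spE' n : subm (pow n [set: E']). Proof. exact: subm_powI. Qed.
Let sV n : subm (V n). Proof. exact: subm_add. Qed.
Let sU n : subm (U n). Proof. exact: subm_preim. Qed.

Let ZU n : Z `<=` U n.
Proof. by move=> x /= Dx; rewrite /= Dx; exact: (subm0 (spE' n)). Qed.

Let VU n : V n `<=` U n.
Proof.
apply: addm_sub => //; first exact: subset_trans (ZU n).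
by move=> x; exact: (powI_map (f := D)).
Qed.

Let finV n : fin (V n) setT. Proof. exact: (fin_add_pow noethA A_local I_primary). Qed.

Lemma fin_reduction n : fin (V n) (U n).
Proof. by apply: fin_sub (finV n). Qed.

Let U_artin_rees : exists c, forall n,
  D @` setT `&` pow (n + c) setT = pow n (D @` U c).
Proof.
have [c cP] := artin_rees noethE' Ixs (subm_im D (@subm_setT _ E)).
exists c => n; rewrite cP; congr (powI _ n _); apply/seteqP; split=> y.
  by move=> [[x _ <-] py]; exists x.
by move=> [x Ux <-]; split=> //; exists x.
Qed.

(** By Artin-Rees, I^(n+c) E meets W inside I^n W. *)
Lemma size_sub_growth (W : set E) s : subm W -> epoly_size (fun n => len (pow n W) W) s ->
  (s <= d.+1)%N.
Proof.
move=> sW Ws; have [c cP] := artin_rees noethE Ixs sW.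
have [t Et] := chi_poly noethA A_local I_primary Ixs noethE (@subm_set1 _ E) (@subm_setT _ E) (@subsetT _ _).
have chiE n : chi I [set 0] [set: E] n = len (pow n [set: E]) setT by exact: pow_chi0.
have [C CP] := E_growth; have td : (t <= d.+1)%N.
  by apply: (epoly_size_bound (C := C) Et) => n; rewrite chiE.
apply: leq_trans td; apply: (epoly_size_leq (N := 0) Ws (epoly_size_shift c Et)) => n _.
rewrite chiE; have sn : subm (pow n W) by exact: subm_powI.
have WI : W `&` pow (n + c) setT `<=` pow n W.
  by rewrite cP; apply: powIS; exact: subIsetl.
suff [] : fin (pow n W) W /\ (len (pow n W) W <= len (pow (n + c) [set: E]) setT)%N by [].
apply: (len_inj (f := idfun)) => //; first exact: powI_sub.
  by move=> w Ww pw; apply: WI.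
exact: (fin_pow noethA A_local I_primary (n := n + c) noethE).
Qed.

(** The length of U n/V n is the difference of those of E/V n and E/U n, and the
    latter is that of the image of D modulo its intersection with I^n E'. *)
Lemma reduction_poly : exists s, epoly_size (fun n => len (V n) (U n)) s.
Proof.
apply: epoly_sizeP; have [c cP] := U_artin_rees.
pose F := D @` setT; pose W := D @` U c.
have sF : subm F by exact: subm_im.
have sW : subm W by exact: subm_im.
have WF : W `<=` F by move=> _ [x _ <-]; exists x.
have [s [p [_ [N pN]]]] := chi_poly noethA A_local I_primary Ixs noethE sB (@subm_setT _ E) (@subsetT _ _).
have [t [q [_ [K qK]]]] := chi_poly noethA A_local I_primary Ixs noethE' (@subm_set1 _ E') sW (set1_sub sW).
have finF n : fin (F `&` pow n setT) F.
  apply: (fin_pow noethA A_local I_primary (n := n) noethE') => //; first exact: submI.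
  by move=> x px; split; [exact: (powI_sub sF px)|exact: (powIS (@subsetT _ _) px)].
have lenUF n : len (U n) setT = len (F `&` pow n setT) F.
  have sFn : subm (F `&` pow n setT) by exact: submI.
  have [fU le1] : fin (U n) setT /\ (len (U n) setT <= len (F `&` pow n setT) F)%N.
    apply: (len_inj (f := D)) => //; last by move=> x _; exists x.
    by move=> x _ [].
  have [_ le2] : fin (F `&` pow n setT) F /\ (len (F `&` pow n setT) F <= len (U n) setT)%N.
    apply: (len_surj (f := D)) => //; first by move=> x Ux; split=> //; exists x.
    by move=> _ [x _ <-]; exists x => //; rewrite subrr; exact: (subm0 sFn).
  by apply/eqP; rewrite eqn_leq le1.
have lenF n : len (F `&` pow (n + c) setT) F = (chi I [set 0%R] W n + len W F)%N.
  have sn : subm (pow n W) by exact: subm_powI.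
  have nW : pow n W `<=` W by exact: powI_sub.
  have fnF : fin (pow n W) F by rewrite -cP.
  rewrite cP pow_chi0 //; apply: (len_add sn sW sF nW WF _ _).2.
    exact: fin_sub fnF.
  exact: fin_sub fnF.
apply: (epoly_shiftI (c := c)); exists (p \Po ('X + c%:R%:P) - (q + (len W F)%:R%:P)), (maxn N K).
move=> n; rewrite geq_max => /andP[Nn Kn].
have [||_ E1] := len_add (sV (n + c)) (sU (n + c)) (@subm_setT _ E) (@VU (n + c)) (@subsetT _ _).
- exact: fin_reduction.
- by apply: fin_sub (finV (n + c)) => //; exact: VU.
rewrite lenUF lenF in E1; rewrite hornerD hornerN hornerD hornerC horner_comp hornerD hornerX hornerC.
rewrite -natrD -pN ?(leq_trans Nn) ?leq_addr // -qK //.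
by rewrite /chi E1 !natrD addrK.
Qed.

(** U (n+c) = Z + I^n (U c) lies over V (n+c), which contains B and
    I^(n+c) (U c); so the length is at most that of Z/B plus a difference of
    the Hilbert-Samuel function of U c. *)
Lemma reduction_growth : exists2 s, (s <= d)%N & epoly_size (fun n => len (V n) (U n)) s.
Proof.
have [s Vs] := reduction_poly; exists s => //; have [c cP] := U_artin_rees.
pose g n := len (pow (n + c) (U c)) (pow n (U c)).
have sp n : subm (pow n (U c)) by exact: subm_powI.
have le_pow n : pow (n + c) (U c) `<=` pow n (U c) by apply: powI_leq => //; exact: leq_addr.
have fing n : fin (pow (n + c) (U c)) (pow n (U c)).
  apply: (fin_pow noethA A_local I_primary (n := n + c) noethE) => //.
  by apply: powIS; exact: powI_sub.
have [t Ut] : exists t, epoly_size (fun n => len (pow n (U c)) (U c)) t.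
  have [t [p [sp' [N pN]]]] := chi_poly noethA A_local I_primary Ixs noethE (@subm_set1 _ E) (sU c) (set1_sub (sU c)).
  by exists t, p; split=> //; exists N => n /pN; rewrite pow_chi0.
have td := size_sub_growth (sU c) Ut.
have [u ut gu] : exists2 u, (u <= t.-1)%N & epoly_size g u.
  apply: (epoly_size_diff (c := c) Ut) => n; rewrite [RHS]addnC.
  have nU : pow n (U c) `<=` U c by exact: powI_sub.
  apply: (len_add (sp (n + c)) (sp n) (sU c) (le_pow n) nU (fing n) _).2.
  exact: (fin_pow noethA A_local I_primary (n := n) noethE).
have [v v1 kv] := epoly_sizeC (len B Z).
have [w wm hw] := epoly_sizeD kv gu.
have wd : (w <= d)%N.
  apply: leq_trans wm _; rewrite geq_max (leq_trans v1 d0) (leq_trans ut) //.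
  by case: (t) td.
apply: leq_trans wd; apply: (epoly_size_leq (N := 0) (epoly_size_shift c Vs) hw) => n _.
set k := (n + c)%N; pose V' := addm Z (V k).
have sV' : subm V' by exact: subm_add.
have VV' : V k `<=` V' by exact: addmr.
have V'U : V' `<=` U k by exact: addm_sub.
have fVU := fin_reduction k.
have [||_ ->] := len_add (sV k) sV' (sU k) VV' V'U.
- exact: fin_sub fVU.
- exact: fin_sub fVU.
apply: leq_add.
  suff [] : fin (V k) V' /\ (len (V k) V' <= len B Z)%N by [].
  apply: (len_surj (f := idfun)) => //; first by move=> b Bb; exact: addml.
suff [] : fin V' (U k) /\ (len V' (U k) <= g n)%N by [].
apply: (len_surj (f := idfun)) => //.
  move=> x px; apply: VV'; apply: addmr => //.
  exact: (powIS (@subsetT _ _) px).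
move=> x Ux; have : (D @` setT `&` pow k setT) (D x) by split=> //; exists x.
rewrite cP => Dx.
have [y py Dy] : exists2 y, pow n (U c) y & D y = D x.
  by apply: (powI_lift (V := D @` U c)) => //; move=> _ [z Uz <-]; exists z.
exists y => //; apply: addml => //.
by rewrite /= linearB Dy subrr.
Qed.

End TwoTerm.

Section Socle.
Variable M : lmodType A.
Implicit Types (V : set M) (J : set A^o).

Definition colon V J : set M := [set v | forall a, J a -> V ((a : A) *: v)].

Lemma subm_colon V J : subm V -> subm (colon V J).
Proof.
move=> sV; split=> [a _|b x y Vx Vy a Ja]; first by rewrite scaler0; exact: subm0.
rewrite scalerDr scalerA mulrC -scalerA.
exact: (submD sV (submZ b sV (Vx a Ja)) (Vy a Ja)).
Qed.

Lemma colon_sub V J : subm V -> V `<=` colon V J.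
Proof. by move=> sV v Vv a _; exact: submZ. Qed.

(** Climb from I to A through ideals J + a A with m a in J: multiplication by a
    embeds (V : J)/(V : J + a A) into (V : m)/V. *)
Lemma socle_bound : exists k, forall V, subm V -> fin V setT ->
  (len V (colon V (mset I)) <= k * len V (colon V (mset m)))%N.
Proof.
suff main J : subm J -> mset I `<=` J -> exists k, forall V, subm V -> fin V setT ->
    (len V (colon V J) <= k * len V (colon V (mset m)))%N.
  exact: main (subm_mset I) (@subset_refl _ _).
move: J; apply: (acc_ind noethA) => J sJ IH IJ.
have [J1|J1] := pselect (J 1).
  exists 0%N => V sV fV; have -> : colon V J = V; last by rewrite (len_refl sV).2.
  apply/seteqP; split; last exact: colon_sub.
  by move=> v /(_ 1 J1); rewrite scale1r.
have [|a [_ Ja ma]] := @torsion_socle _ m noethA _ _ _ _ sJ (@subm_setT _ A^o) _ Logic.I J1.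
  move=> a /(I_primary.2 a)[n an]; exists n => u _; rewrite [_ *: _]mulrC.
  exact: (submZ u sJ (IJ _ an)).
pose J' := addm J (scale_by a @` setT).
have sa : subm (scale_by a @` setT) by exact: subm_im.
have sJ' : subm J' by exact: subm_add.
have JJ' : J `<=` J' by exact: addml.
have [||k kP] := IH J' sJ' JJ'.
- by move=> J'J; apply/Ja/J'J; apply: addmr => //; exists 1 => //; rewrite /scale_by scale1r.
- exact: subset_trans JJ'.
exists k.+1 => V sV fV; rewrite mulSn addnC.
have s1 := subm_colon J sV; have s2 := subm_colon J' sV; have s3 := subm_colon (mset m) sV.
have V1 : V `<=` colon V J' by exact: colon_sub.
have V2 : colon V J' `<=` colon V J by move=> v Vv b Jb; apply: Vv; exact: JJ'.
have f1 : fin V (colon V J') by exact: fin_sub fV.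
have f2 : fin (colon V J') (colon V J) by exact: fin_sub fV.
have [_ ->] := len_add sV s2 s1 V1 V2 f1 f2.
apply: leq_add; first exact: kP.
suff [] : fin (colon V J') (colon V J) /\
    (len (colon V J') (colon V J) <= len V (colon V (mset m)))%N by [].
apply: (len_inj (f := homothety (a : A))) => //; first exact: colon_sub.
- move=> v Vv Vav b [j Jj [c _ cE]].
  rewrite -(subrK j b) scalerDl; apply: submD => //; last exact: Vv.
  by rewrite -cE /scale_by -scalerA; exact: submZ.
- move=> v Vv b mb; rewrite /= /homothety scalerA.
  exact/Vv/ma.
- exact: fin_sub fV.
Qed.

(** I annihilates the submodule I^(n-1) M/I^n M of M/I^n M; by [socle_bound] its
    length, a polynomial of degree one less than the dimension, bounds that of
    the socle from below up to a constant factor. *)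
Lemma socle_growth : (0 < krull_dim M)%N -> noeth M -> fin_gen M ->
  forall f s, epoly_size f s ->
  (forall n, len (pow n setT) (colon (pow n setT) (mset m)) <= f n)%N ->
  (krull_dim M <= s)%N.
Proof.
move=> M0 noethM fgM f s fs fP.
have hs := hilbert_samuel_degree noethA A_local I_primary Ixs M0 noethM fgM.
have sp n : subm (pow n [set: M]) by exact: subm_powI.
have fp n : fin (pow n [set: M]) setT.
  exact: (fin_pow noethA A_local I_primary (n := n) noethM).
have SS n : pow n.+1 [set: M] `<=` pow n [set: M] by apply: powI_leq.
have /= := epoly_size_diff1 hs (g := fun n => len (pow n.+1 [set: M]) (pow n setT)) _.
have [k kP] := socle_bound.
move=> gs; apply: (epoly_size_leq (N := 0) (gs _) (epoly_size_scale (ltn0Sn k) (epoly_size_shift 1 fs))).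
  move=> n; rewrite addnC; apply: (len_add (sp n.+1) (sp n) _ (@SS n) _ _ (fp n)).2 => //.
  exact: fin_sub (fp n.+1).
move=> n _; rewrite addn1; apply: (@leq_trans (k * f n.+1)); last by rewrite leq_mul2r leqnSn orbT.
apply: leq_trans (leq_mul (leqnn k) (fP n.+1)); apply: leq_trans (kP _ (sp n.+1) (fp n.+1)).
apply: len_sub => //; [exact: SS| |by apply: fin_sub (fp n.+1)].
by move=> v pv a Ia; exact: mem_mulI.
Qed.

End Socle.

End ReductionGrowth.

(** * The Hilbert function of a perfect complex *)

Section Assembly.
Variables (A : comNzRingType) (m I : idealr A) (M : lmodType A) (X : complex A).
Hypotheses (noethA : noeth A^o) (A_local : local_ring m) (I_primary : primary_to m I).
Variable xs : seq A.
Hypothesis Ixs : forall a, mset I a <-> gspan [set` (xs : seq A^o)] a.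
Hypotheses (M_fin_gen : fin_gen M) (M_dim : (0 < krull_dim M)%N).
Hypothesis X_perf : perfect_finite_length X.

Local Notation T i := (tensor (X i) M).
Local Notation XM := (tensor_complex X M).
Local Notation coh_len i n :=
  (length (cohomology (tensor_complex X (quotmod (pow_submod I M n))) i)).

Lemma noeth_term i : noeth (X i).
Proof. by have [_ /(_ i)[fg _] _] := X_perf; exact: noeth_fin_gen. Qed.

Lemma noeth_tensor i : noeth (T i).
Proof.
have [_ /(_ i)[fg _] _] := X_perf.
apply: noeth_fin_gen => //; exact: tensor_fin_gen.
Qed.

Lemma fin_tensor_cohomology i : fin (@boundaries A XM i) (@cycles A XM i).
Proof.
have [bX pX fX] := X_perf.
have B0 : subm (@boundaries A XM i) by exact: subm_boundaries.
have Z0 : subm (@cycles A XM i) by exact: subm_cycles.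
have nT : noeth (XM i) by exact: noeth_tensor.
have BZ : @boundaries A XM i `<=` @cycles A XM i by exact: boundaries_cycles.
apply: (fin_torsion noethA A_local nT B0 Z0 BZ) => a ma.
apply: (cycles_torsion_tensor noethA A_local bX _ noeth_term M ma fX i).
by move=> j; have [] := pX j.
Qed.

Lemma tensor_growth i : exists C, forall n,
  (len (powI (mset I) n [set: T i]) setT <= C * n.+1 ^ krull_dim M)%N.
Proof.
have [_ /(_ i)[fg _] _] := X_perf.
apply: (hilbert_samuel_upper noethA A_local I_primary M_dim (@noeth_tensor i)).
  exact: tensor_fin_gen.
by move=> a t aM; exact: tensor_ann.
Qed.

Lemma coh_lenE i n : coh_len i n = len (@lifted_boundaries A X I M n i) (@lifted_cycles A X I M n i).
Proof.
apply: cohomology_reduction_len.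
apply: (fin_reduction noethA A_local I_primary (diff XM i (i + 1)) (@noeth_tensor i)).
exact: subm_boundaries.
Qed.

Lemma coh_len_growth i : exists2 s, (s <= krull_dim M)%N & epoly_size (fun n => coh_len i n) s.
Proof.
have [s sd [p [sp [N pN]]]] := reduction_growth noethA A_local I_primary Ixs (@noeth_tensor i)
  (@noeth_tensor (i + 1)) (@subm_boundaries A XM i) (@boundaries_cycles A XM i)
  (fin_tensor_cohomology i) (tensor_growth i) M_dim.
by exists s => //; exists p; split=> //; exists N => n /pN <-; rewrite coh_lenE.
Qed.

(** The map v |-> x (x) v carries the elements of M/I^n M killed by m to
    cocycles, since d x lies in m X.  It is injective modulo coboundaries, because
    e kills those and fixes x, and some functional takes the value 1 at x. *)
Lemma socle_cohomology i n : obstruction m X i ->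
  (len (powI (mset I) n setT) (colon (powI (mset I) n [set: M]) (mset m)) <= coh_len i n)%N.
Proof.
move=> [e [x [ed ex mdx nmx]]].
have [_ /(_ i)[_ pX] _] := X_perf.
have [phi phi1] := projective_functional noethA A_local pX nmx.
set V := powI _ n _; have sV : subm V by exact: subm_powI.
rewrite coh_lenE.
have fVU : fin (@lifted_boundaries A X I M n i) (@lifted_cycles A X I M n i).
  apply: (fin_reduction noethA A_local I_primary (diff XM i (i + 1)) (@noeth_tensor i)).
  exact: subm_boundaries.
apply: (@len_inj _ _ _ (@tens_of A (X i) M x) _ _ _ _ sV _ (subm_lifted_boundaries X I M n i)
  (subm_lifted_cycles X I M n i) (@lifted_boundaries_cycles A X I M n i) _ _ _ fVU).2.
- exact: colon_sub.
- exact: subm_colon.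
- move=> v _ [_ [t _ <-] pt].
  pose em : {linear T i -> T i} := tensor_map (N := M) e.
  pose ev : {linear T i -> M} := tensor_eval phi.
  have em0 : em (diff XM (i - 1) i t) = 0.
    have E : forall t, (em \o diff XM (i - 1) i) t = (\0 : {linear T (i - 1) -> T i}) t.
      apply: tensor_ext => y w.
      have E1 : diff XM (i - 1) i (tens y w) = tens (diff X (i - 1) i y) w.
        exact: tensor_map_tens.
      have E2 : em (tens (diff X (i - 1) i y) w) = tens (e (diff X (i - 1) i y)) w.
        exact: tensor_map_tens.
      by rewrite [LHS]/= E1 E2 ed tens0l.
    exact: E.
  have emx : em (tens_of x v) = tens_of x v.
    by rewrite /em [LHS]tensor_map_tens ex.
  have evx : ev (tens_of x v) = v.
    by rewrite /ev [LHS]tensor_eval_tens phi1 scale1r.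
  have pem := powI_map (f := em) (V := setT) (fun _ _ => Logic.I) pt.
  have := powI_map (f := ev) (V := setT) (fun _ _ => Logic.I) pem.
  by rewrite linearB em0 subr0 emx evx.
- move=> v mv; rewrite /lifted_cycles /=.
  have -> : diff XM i (i + 1) (tens_of x v) = tens (diff X i (i + 1) x) v.
    exact: tensor_map_tens.
  have sp : subm (powI (mset I) n [set: T (i + 1)]) by exact: subm_powI.
  pose W : set (X (i + 1)) := [set y | powI (mset I) n [set: T (i + 1)] (tens y v)].
  have sW : subm W.
    split=> [|a y z Wy Wz]; rewrite /W /=; first by rewrite tens0l; exact: (subm0 sp).
    by rewrite tensPl; exact: (submD sp (submZ a sp Wy) Wz).
  have mW : mulI (mset m) setT `<=` W.
    apply: mulI_sub => // a y ma _.
    have -> : W (a *: y) = powI (mset I) n [set: T (i + 1)] (tens y (a *: v)).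
      by rewrite /W /mkset tensZl tensZr.
    exact/pow_tens/mv.
  exact: mW.
Qed.

Lemma coh_len_zero i n : (forall x : X i, x = 0) -> coh_len i n = 0%N.
Proof.
move=> X0; have T0 (t : T i) : t = 0.
  apply: (tensor_ind (S := [set 0]) (@subm_set1 _ (T i))) t => x y.
  by rewrite (X0 x) /= tens0l.
rewrite coh_lenE; set V := @lifted_boundaries A X I M n i; set U := @lifted_cycles A X I M n i.
have sV : subm V by exact: subm_lifted_boundaries.
have sU : subm U by exact: subm_lifted_cycles.
have -> : U = V; last by rewrite (len_refl sV).2.
apply/seteqP; split=> t _; rewrite (T0 t); [exact: (subm0 sV)|exact: (subm0 sU)].
Qed.

Lemma psi_sum : exists r : seq int, (forall i, i \notin r -> forall x : X i, x = 0) /\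
  forall n, psi I M X n = \sum_(i <- r) coh_len i n.
Proof.
have [[b bP] _ _] := X_perf.
pose r := [seq (k%:Z - b%:Z : int) | k <- iota 0 (b + b).+1].
have rP i : i \notin r -> forall x : X i, x = 0.
  move=> ir; apply: bP; rewrite ltNge; apply: contra ir => ib.
  apply/mapP; exists (absz (i + b%:Z)%R); last by move: ib; lia.
  by rewrite mem_iota; move: ib; lia.
exists r; split=> // n; rewrite /psi.
rewrite (@fsbigE _ _ _ _ _ r) //.
- by apply: eq_bigl => i; rewrite in_setT.
- by rewrite map_inj_uniq ?iota_uniq // => k l; lia.
- by move=> i _ ir; apply: coh_len_zero; exact: rP.
Qed.

Lemma psi_growth : (exists i, obstruction m X i) ->
  epoly_size (psi I M X) (krull_dim M).
Proof.
move=> [i0 ob]; have [r [rP psiE]] := psi_sum.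
have sum_growth (t : seq int) : exists2 s, (s <= krull_dim M)%N &
    epoly_size (fun n => \sum_(i <- t) coh_len i n)%N s.
  elim: t => [|i t [s sd ts]].
    exists 0%N => //; exists 0; rewrite size_poly0; split=> //; exists 0%N => n _.
    by rewrite big_nil horner0.
  have [u ud iu] := coh_len_growth i.
  have [w wm [p [pw [N pN]]]] := epoly_sizeD iu ts.
  exists w; first by apply: leq_trans wm _; rewrite geq_max ud sd.
  by exists p; split=> //; exists N => n /pN <-; rewrite big_cons.
have [s sd [p [ps [N pN]]]] := sum_growth r.
have fs : epoly_size (psi I M X) s by exists p; split=> //; exists N => n /pN; rewrite psiE.
suff -> : krull_dim M = s by [].
apply/eqP; rewrite eqn_leq sd andbT.
have M_noeth : noeth M by exact: noeth_fin_gen.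
apply: (socle_growth noethA A_local I_primary Ixs M_dim M_noeth M_fin_gen fs) => n.
apply: leq_trans (socle_cohomology n ob) _; rewrite psiE.
have i0r : i0 \in r.
  apply: contrapT => /negP i0r; have [e [x [_ _ _ nmx]]] := ob.
  by apply: nmx; rewrite (rP _ i0r x); exact: (subm0 (subm_mulI _ _)).
by rewrite (big_rem i0) //= leq_addr.
Qed.

End Assembly.

Theorem theorem1p4 (A : comNzRingType) (m : idealr A) (M : lmodType A)
    (I : idealr A) (X : complex A)
    (A_noetherian : noetherian A)
    (A_local : local_ring m)
    (M_fin_gen : fin_gen M)
    (M_dim : (0 < krull_dim M)%N)
    (I_primary : primary_to m I)
    (X_perf : perfect_finite_length X)
    (X_nonzero : ~ homotopy_equivalent X (zero_complex A)) :
  polynomial_type_degree (psi I M X) (krull_dim M - 1)%N.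
Proof.
have noethA := noeth_ring A_noetherian.
have [xs Ixs] := noetherian_gens A_noetherian (subm_mset I).
have [bX pX _] := X_perf.
have [|i ob] := nonzero_obstruction noethA A_local bX _ (noeth_term noethA X_perf) X_nonzero.
  by move=> i; have [] := pX i.
have [p [pd pP]] := psi_growth noethA A_local I_primary Ixs M_fin_gen M_dim X_perf
  (ex_intro _ i ob).
by exists p; split=> //; rewrite pd subn1 prednK.
Qed.
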